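(* Let $G$ be a finite group. The functors $A:N_\infty\text{-}\mathbf{Op}^G\to\mathbf{Ind}(G)$ and $A:N\text{-}\mathbf{Op}^G\to\mathbf{Ind}(G)$ have functorial sections. In particular, there is a section $$\mathbf{F}:\mathbf{Ind}(G)\to N\text{-}\mathbf{Op}^G$$ of $A:N\text{-}\mathbf{Op}^G\to\mathbf{Ind}(G)$ given by the formula $\mathbf{F}(\mathcal{I})=\mathbf{F}_{\mathbf{O}(\mathcal{I})}$, where $\mathbf{O}(\mathcal{I})$ is the set of nontrivial orbits $H/K\in\mathcal{I}$. The operad $\mathbf{F}(\mathcal{I})$ is a finitely generated free operad for every $\mathcal{I}\in\mathbf{Ind}(G)$.
   Context: $G$ is a finite group with unit $e$; spaces are compactly generated weak Hausdorff. An operad in left $G$-spaces (resp. $G$-sets) is a symmetric operad in that cartesian monoidal category: objects $\mathscr{O}(n)$, $n\ge 0$, with commuting left $G$- and right $\Sigma_n$-actions (regarded as one left $G\times\Sigma_n$-action $(g,\sigma)\cdot f=gf\sigma^{-1}$), a $G$-fixed identity, and $G$-equivariant composition $\gamma$ satisfying May's axioms. A graph subgroup of $G\times\Sigma_n$ is a subgroup $\Gamma$ with $\Gamma\cap(\{e\}\times\Sigma_n)$ trivial. For a subgroup $H\subset G$ and a finite $H$-set $T$, choose a total order on $T$, let $\sigma:H\to\Sigma_{|T|}$ be the resulting permutation representation, and put $\Gamma(T)=\{(h,\sigma(h))\mid h\in H\}\subset G\times\Sigma_{|T|}$. An $N_\infty$ operad is an operad $\mathscr{O}$ in $G$-spaces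 such that each $\mathscr{O}(n)$ is $\Sigma_n$-free, $\mathscr{O}(n)^\Gamma$ is empty or contractible for every $n$ and graph subgroup $\Gamma\subset G\times\Sigma_n$, and $\mathscr{O}(0)^G,\mathscr{O}(2)^G$ are nonempty. An $N$ operad is an operad in $G$-sets such that each $\mathscr{O}(n)$ is $\Sigma_n$-free and $\mathscr{O}(0)^G,\mathscr{O}(2)^G$ are nonempty. $N_\infty\text{-}\mathbf{Op}^G$, $N\text{-}\mathbf{Op}^G$ are the corresponding categories, with all operad maps. A finite $H$-set $T$ ($H\subset G$ a subgroup) is admissible for $\mathscr{O}$ if $\mathscr{O}(|T|)^{\Gamma(T)}\ne\varnothing$ (independent of the order on $T$); $A(\mathscr{O})$ is the class of all admissible sets. It is a $G$-indexing system, and an operad map $\mathscr{O}_1\to\mathscr{O}_2$ gives $A(\mathscr{O}_1)\subset A(\mathscr{O}_2)$. A $G$-indexing system $\mathcal{I}$ is a choice, for each subgroup $H\subset G$, of a class $\mathcal{I}(H)$ of finite $H$-sets such that, for all subgroups $K\subset H\subset G$: (1) $\mathcal{I}(H)$ contains all finite trivial $H$-actions; (2) $\mathcal{I}(H)$ is closed under isomorphism; (3) $T\in\mathcal{I}(H)$ implies $\mathrm{res}^H_KT\in\mathcal{I}(K)$; (4) $T\in\mathcal{I}(H)$ and $a\in G$ imply $c_aT\in\mathcal{I}(aHa^{-1})$, where $c_aT$ is $T$ with the conjugated action; (5) $\mathcal{I}(H)$ is closed under sub-$H$-sets; (6) $\mathcal{I}(H)$ is closed under binary coproducts; (7) if $T\in\mathcal{I}(K)$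 and $H/K\in\mathcal{I}(H)$, then $\mathrm{ind}_K^HT\in\mathcal{I}(H)$. $\mathbf{Ind}(G)$ is the poset (category) of $G$-indexing systems under levelwise inclusion. A functorial section of $A$ is a functor whose composite with $A$ is the identity of $\mathbf{Ind}(G)$. A symmetric sequence of $G$-sets is a sequence of $G\times\Sigma_n$-sets, $n\ge 0$; $F$ is the left adjoint of the forgetful functor from operads in $G$-sets to symmetric sequences of $G$-sets. For an indexed set $\mathcal{T}=(T_\alpha)_{\alpha\in J}$ of finite $G$-subgroup actions (each $T_\alpha$ is a finite $H_\alpha$-set for some subgroup $H_\alpha\subset G$), let $$S_{\mathcal{T}}=\frac{G\times\Sigma_0}{G\times\{\mathrm{id}_0\}}\sqcup\frac{G\times\Sigma_2}{G\times\{\mathrm{id}_2\}}\sqcup\coprod_{\alpha\in J}\frac{G\times\Sigma_{|T_\alpha|}}{\Gamma(T_\alpha)},$$ where each orbit of $G\times\Sigma_n$ is placed in level $n$, and let $\mathbf{F}_{\mathcal{T}}=F(S_{\mathcal{T}})$ (an $N$ operad). An orbit $H/K$ ($K\subset H\subset G$ subgroups) is nontrivial if $K\neq H$. *)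

(* Defs.v *)
From HB Require Import structures.
From mathcomp Require Import all_boot all_order all_fingroup all_algebra.
From mathcomp Require Import all_classical reals topology normedtype.
Set Implicit Arguments.
Unset Strict Implicit.
Unset Printing Implicit Defensive.

Import GroupScope numFieldNormedType.Exports.
Local Open Scope group_scope.

Record Category := {
  ob :> Type;
  mor : ob -> ob -> Type;
  idmor : forall x, mor x x;
  cmp : forall x y z, mor y z -> mor x y -> mor x z;
  cmpA : forall x y z w (h : mor z w) (g : mor y z) (f : mor x y),
    cmp h (cmp g f) = cmp (cmp h g) f;
  cmp1m : forall x y (f : mor x y), cmp (idmor y) f = f;
  cmpm1 : forall x y (f : mor x y), cmp f (idmor x) = f }.

Record Functor (C D : Category) := {
  fob :> C -> D;
  fmor : forall x y, mor x y -> mor (fob x) (fob y);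
  fmor1 : forall x, fmor (idmor x) = idmor (fob x);
  fmorM : forall x y z (g : mor y z) (f : mor x y),
    fmor (cmp g f) = cmp (fmor g) (fmor f) }.

Definition functor_id (C : Category) : Functor C C.
Proof. by exists (fun x => x) (fun _ _ f => f). Defined.

Definition functor_comp (C D E : Category) (G : Functor D E) (F : Functor C D) :
  Functor C E.
Proof.
exists (fun x => G (F x)) (fun x y f => fmor G (fmor F f)).
- by move=> x; rewrite !fmor1.
- by move=> x y z g f; rewrite !fmorM.
Defined.

Definition functorial_section (C D : Category) (A : Functor C D)
  (S : Functor D C) : Prop := functor_comp A S = functor_id D.

Definition full_subcategory (C : Category) (P : C -> Prop) : Category.
Proof.
exists {x : C | P x} (fun x y => mor (sval x) (sval y))
       (fun x => idmor (sval x)) (fun x y z g f => cmp g f).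
- by move=> *; exact: cmpA.
- by move=> *; exact: cmp1m.
- by move=> *; exact: cmpm1.
Defined.

Definition isomorphic (C : Category) (x y : C) : Prop :=
  exists (f : mor x y) (g : mor y x), cmp g f = idmor x /\ cmp f g = idmor y.

Record LeftAdjoint (C D : Category) (U : Functor D C) := {
  la_functor :> Functor C D;
  la_unit : forall c : C, mor c (U (la_functor c));
  la_unit_natural : forall (c c' : C) (f : mor c c'),
    cmp (fmor U (fmor la_functor f)) (la_unit c) = cmp (la_unit c') f;
  la_universal : forall (c : C) (d : D) (f : mor c (U d)),
    exists! g : mor (la_functor c) d, cmp (fmor U g) (la_unit c) = f }.

(* The product of two elements of 'S_n is (s * t) i = t (s i) in MathComp.  In *)
(* Sigma n it is composition of functions, (s * t) i = s (t i), so that        *)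
(* symmetric group actions and permutation representations of left H-sets obey *)
(* the usual conventions.                                                      *)
Definition Sigma (n : nat) : Type := 'S_n.
HB.instance Definition _ n := Finite.on (Sigma n).

Section SigmaGroup.
Variable n : nat.
Definition sigma_mul (s t : Sigma n) : Sigma n := ((t : 'S_n) * (s : 'S_n))%g.
Definition sigma_one : Sigma n := (1 : 'S_n)%g.
Definition sigma_inv (s : Sigma n) : Sigma n := ((s : 'S_n)^-1)%g.
Fact sigma_mulA : associative sigma_mul.
Proof. by move=> s t u; rewrite /sigma_mul mulgA. Qed.
Fact sigma_mul1 : left_id sigma_one sigma_mul.
Proof. by move=> s; exact: mulg1. Qed.
Fact sigma_mulV : left_inverse sigma_one sigma_inv sigma_mul.
Proof. by move=> s; exact: mulgV. Qed.
HB.instance Definition _ :=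
  Finite_isGroup.Build (Sigma n) sigma_mulA sigma_mul1 sigma_mulV.
End SigmaGroup.

Definition sigma_fun n (s : Sigma n) : 'I_n -> 'I_n := (s : 'S_n).
Coercion sigma_fun : Sigma >-> Funclass.

Definition mk_sigma n (f : 'I_n -> 'I_n) (f_inj : injective f) : Sigma n :=
  perm f_inj.

Lemma mk_sigmaE n (f : 'I_n -> 'I_n) (f_inj : injective f) i :
  mk_sigma f_inj i = f i.
Proof. exact: permE. Qed.

Lemma sigmaP n (s t : Sigma n) : (forall i, s i = t i) -> s = t.
Proof. by move=> st; apply/permP. Qed.

Lemma sigmaM n (s t : Sigma n) i : (s * t : Sigma n) i = s (t i).
Proof. exact: permM. Qed.

Lemma sigma1 n i : (1 : Sigma n) i = i.
Proof. exact: perm1. Qed.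

Lemma sigma_inj n (s : Sigma n) : injective s.
Proof. exact: perm_inj. Qed.

Lemma sigmaK n (s : Sigma n) : cancel s (s^-1 : Sigma n)%g.
Proof. exact: permK. Qed.

Lemma sigmaKV n (s : Sigma n) : cancel (s^-1 : Sigma n)%g s.
Proof. exact: permKV. Qed.

(* tagnat.Rank i l is the position of the l-th letter of the i-th block in a   *)
(* concatenation of k blocks of lengths j 0, ..., j (k - 1); tagnat.sig1 and   *)
(* tagnat.sig2 recover i and l.                                                *)

Section Blocks.
Variables (k : nat) (j : 'I_k -> nat).

(* t_1 (+) ... (+) t_k *)
Definition block_sum_fun (t : forall i, Sigma (j i)) (a : 'I_(\sum_i j i)) :
  'I_(\sum_i j i) :=
  tagnat.Rank (tagnat.sig1 a) (t (tagnat.sig1 a) (tagnat.sig2 a)).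

Fact block_sum_inj (t : forall i, Sigma (j i)) : injective (block_sum_fun t).
Proof.
move=> a b /tagnat.rank_inj; rewrite -(tagnat.sigK a) -(tagnat.sigK b).
rewrite /tagnat.sig1 /tagnat.sig2 !tagnat.rankK.
case: (tagnat.sig a) (tagnat.sig b) => [i l] [i' l'] /= e.
have ei : i = i' := congr1 tag e.
case: _ / ei l' e => l' /eqP; rewrite eq_Tagged => /eqP /sigma_inj -> //.
Qed.

Definition block_sum (t : forall i, Sigma (j i)) : Sigma (\sum_i j i) :=
  mk_sigma (@block_sum_inj t).

(* s<j_1, ..., j_k>: the i-th block of the partition by the j (s i) is moved   *)
(* to the s(i)-th block of the partition by the j i.                           *)
Fact block_perm_size (s : Sigma k) : \sum_i j i = \sum_i j (s i).
Proof. by rewrite (reindex_inj (@sigma_inj k s)). Qed.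

Definition block_perm_fun (s : Sigma k) (a : 'I_(\sum_i j i)) :
  'I_(\sum_i j i) :=
  let b := cast_ord (block_perm_size s) a in
  tagnat.Rank (s (tagnat.sig1 b)) (tagnat.sig2 b).

Fact block_perm_inj (s : Sigma k) : injective (block_perm_fun s).
Proof.
move=> a b; rewrite /block_perm_fun /=.
set a' := cast_ord _ a; set b' := cast_ord _ b => /tagnat.rank_inj e.
apply: (@cast_ord_inj _ _ (block_perm_size s)); rewrite -/a' -/b'.
move: e; rewrite -(tagnat.sigK a') -(tagnat.sigK b').
rewrite /tagnat.sig1 /tagnat.sig2 !tagnat.rankK.
case: (tagnat.sig a') (tagnat.sig b') => [i l] [i' l'] /= e.
have ei : i = i' := sigma_inj (congr1 tag e).
by case: _ / ei l' e => l' /eqP; rewrite eq_Tagged => /eqP /= ->.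
Qed.

Definition block_perm (s : Sigma k) : Sigma (\sum_i j i) :=
  mk_sigma (@block_perm_inj s).

End Blocks.

Record HSet (gT : finGroupType) (H : {group gT}) := {
  hs_car :> finType;
  hs_act : subg_of H -> hs_car -> hs_car;
  hs_act1 : forall x, hs_act 1 x = x;
  hs_actM : forall a b x, hs_act (a * b) x = hs_act a (hs_act b x) }.

Section HSets.
Variable gT : finGroupType.
Implicit Types H K : {group gT}.

Lemma hs_actK H (T : HSet H) a : cancel (@hs_act _ _ T a) (hs_act a^-1).
Proof. by move=> x; rewrite -hs_actM mulVg hs_act1. Qed.

Lemma hs_actVK H (T : HSet H) a : cancel (@hs_act _ _ T a^-1) (hs_act a).
Proof. by move=> x; rewrite -hs_actM mulgV hs_act1. Qed.

(* The permutation representation, for the order of T given by its enumeration *)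
Fact hs_perm_inj H (T : HSet H) (a : subg_of H) :
  injective (fun i : 'I_#|T| => enum_rank (hs_act a (enum_val i))).
Proof. by move=> i j /enum_rank_inj /(can_inj (hs_actK a)) /enum_val_inj. Qed.

Definition hs_perm H (T : HSet H) (a : subg_of H) : Sigma #|T| :=
  mk_sigma (@hs_perm_inj H T a).

Lemma hs_permM H (T : HSet H) a b :
  @hs_perm H T (a * b) = hs_perm T a * hs_perm T b.
Proof.
by apply: sigmaP => i; rewrite sigmaM !mk_sigmaE enum_rankK hs_actM.
Qed.

Lemma hs_perm1 H (T : HSet H) : @hs_perm H T 1 = 1.
Proof. by apply: sigmaP => i; rewrite sigma1 mk_sigmaE hs_act1 enum_valK. Qed.

Definition gammaT_set H (T : HSet H) : {set gT * Sigma #|T|} :=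
  [set (sgval a, hs_perm T a) | a : subg_of H].

Fact gammaT_group_set H (T : HSet H) : group_set (gammaT_set T).
Proof.
apply/group_setP; split.
  by apply/imsetP; exists 1; rewrite // hs_perm1.
move=> p q /imsetP[a _ ->] /imsetP[b _ ->].
by apply/imsetP; exists (a * b); rewrite // hs_permM.
Qed.

Definition gammaT H (T : HSet H) : {group gT * Sigma #|T|} :=
  Group (gammaT_group_set T).

Definition hs_trivial H (T : HSet H) : Prop := forall a x, @hs_act _ _ T a x = x.

Definition hs_iso H (S T : HSet H) : Prop :=
  exists2 f : S -> T, bijective f & forall a x, f (hs_act a x) = hs_act a (f x).

Section Res.
Variables (H K : {group gT}) (sKH : K \subset H).

Definition subg_incl (a : subg_of K) : subg_of H := subg H (sgval a).

Lemma subg_inclE a : sgval (subg_incl a) = sgval a.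
Proof. by rewrite subgK // (fintype.subsetP sKH) // subgP. Qed.

Lemma subg_incl1 : subg_incl 1 = 1.
Proof. by apply: val_inj; rewrite /= subg_inclE. Qed.

Lemma subg_inclM a b : subg_incl (a * b) = subg_incl a * subg_incl b.
Proof. by apply: val_inj; rewrite /= subg_inclE /= !subg_inclE. Qed.

Definition hs_res (T : HSet H) : HSet K.
Proof.
exists (hs_car T) (fun a x => hs_act (subg_incl a) x).
- by move=> x; rewrite subg_incl1 hs_act1.
- by move=> a b x; rewrite subg_inclM hs_actM.
Defined.
End Res.

(* Conjugation: x in a H a^-1 acts on c_a T as a^-1 x a acts on T *)
Section Conj.
Variables (H : {group gT}) (a : gT).

Definition subg_conj (x : subg_of (H :^ a^-1)%G) : subg_of H :=
  subg H (sgval x ^ a).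

Lemma subg_conjE x : sgval (subg_conj x) = sgval x ^ a.
Proof.
by rewrite subgK //; have := subgP x; rewrite /= mem_conjg invgK.
Qed.

Lemma subg_conj1 : subg_conj 1 = 1.
Proof. by apply: val_inj; rewrite /= subg_conjE conj1g. Qed.

Lemma subg_conjM x y : subg_conj (x * y) = subg_conj x * subg_conj y.
Proof. by apply: val_inj; rewrite /= !subg_conjE conjMg. Qed.

Definition hs_conj (T : HSet H) : HSet (H :^ a^-1)%G.
Proof.
exists (hs_car T) (fun x t => hs_act (subg_conj x) t).
- by move=> x; rewrite subg_conj1 hs_act1.
- by move=> x y t; rewrite subg_conjM hs_actM.
Defined.
End Conj.

Section Sub.
Variables (H : {group gT}) (T : HSet H) (U : {set T}).

Definition hs_stable : Prop := forall a x, x \in U -> hs_act a x \in U.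

Hypothesis stU : hs_stable.

Definition hs_sub : HSet H.
Proof.
refine (@Build_HSet gT H {x : T | x \in U}
  (fun a x => exist _ (hs_act a (sval x)) (stU a (svalP x))) _ _).
- by move=> x; apply: val_inj; rewrite /= hs_act1.
- by move=> a b x; apply: val_inj; rewrite /= hs_actM.
Defined.
End Sub.

Definition hs_sum H (S T : HSet H) : HSet H.
Proof.
refine (@Build_HSet gT H (S + T)%type
  (fun a x => match x with inl s => inl (hs_act a s)
                         | inr t => inr (hs_act a t) end) _ _).
- by case=> x; rewrite hs_act1.
- by move=> a b [] x; rewrite hs_actM.
Defined.

(* The orbit H/K, as the set of left cosets of K in H *)
Section Orbit.
Variables H K : {group gT}.

Fact lcosets_stable (a : subg_of H) (C : {C : {set gT} | C \in lcosets K H}) :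
  sgval a *: val C \in lcosets K H.
Proof.
case: C => C /= /lcosetsP[x xH ->].
by rewrite -lcosetM; apply/lcosetsP; exists (sgval a * x); rewrite // groupM ?subgP.
Qed.

Definition hs_orbit : HSet H.
Proof.
refine (@Build_HSet gT H {C : {set gT} | C \in lcosets K H}
  (fun a C => exist _ (sgval a *: val C) (lcosets_stable a C)) _ _).
- by move=> C; apply: val_inj; rewrite /= lcoset1.
- by move=> a b C; apply: val_inj; rewrite /= lcosetM.
Defined.
End Orbit.

(* Induction: H x_K T, the set of K-orbits of pairs (h, t) for the action      *)
(* k . (h, t) = (h k^-1, k t)                                                  *)
Section Ind.
Variables (H K : {group gT}) (T : HSet K).

Definition ind_class (p : subg_of H * T) : {set subg_of H * T} :=
  [set (p.1 * (subg_incl H a)^-1, hs_act a p.2) | a : subg_of K].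

Definition ind_classes : {set {set subg_of H * T}} :=
  [set ind_class p | p : subg_of H * T].

Definition ind_act (h : subg_of H) (C : {set subg_of H * T}) :
  {set subg_of H * T} := [set (h * p.1, p.2) | p in C].

Lemma ind_act_class h p : ind_act h (ind_class p) = ind_class (h * p.1, p.2).
Proof.
apply/finset.setP => q; apply/imsetP/imsetP => [[_ /imsetP[a _ ->] ->]|[a _ ->]].
  by exists a; rewrite //= mulgA.
by exists (p.1 * (subg_incl H a)^-1, hs_act a p.2); rewrite /= ?mulgA ?imset_f.
Qed.

Fact ind_act_stable h (C : {C | C \in ind_classes}) :
  ind_act h (val C) \in ind_classes.
Proof.
by case: C => C /= /imsetP[p _ ->]; rewrite ind_act_class imset_f.
Qed.

Definition hs_ind : HSet H.
Proof.
refine (@Build_HSet gT H {C : {set subg_of H * T} | C \in ind_classes}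
  (fun h C => exist _ (ind_act h (val C)) (ind_act_stable h C)) _ _).
- case=> C cC; apply: val_inj => /=; case/imsetP: cC => p _ ->.
  by rewrite ind_act_class mul1g -surjective_pairing.
- move=> a b [C cC]; apply: val_inj => /=; case/imsetP: cC => p _ ->.
  by rewrite !ind_act_class /= mulgA.
Defined.
End Ind.

End HSets.

Record IndexingSystem (gT : finGroupType) := {
  isys :> forall H : {group gT}, HSet H -> Prop;
  isys_trivial : forall (H : {group gT}) (T : HSet H), hs_trivial T -> isys T;
  isys_iso : forall (H : {group gT}) (S T : HSet H),
    hs_iso S T -> isys S -> isys T;
  isys_res : forall (H K : {group gT}) (sKH : K \subset H) (T : HSet H),
    isys T -> isys (hs_res sKH T);
  isys_conj : forall (H : {group gT}) (a : gT) (T : HSet H),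
    isys T -> isys (hs_conj a T);
  isys_sub : forall (H : {group gT}) (T : HSet H) (U : {set T})
      (stU : hs_stable U), isys T -> isys (hs_sub stU);
  isys_sum : forall (H : {group gT}) (S T : HSet H),
    isys S -> isys T -> isys (hs_sum S T);
  isys_ind : forall (H K : {group gT}) (T : HSet K), K \subset H ->
    isys T -> isys (hs_orbit H K) -> isys (hs_ind H T) }.

Definition isys_le gT (I J : IndexingSystem gT) : Prop :=
  forall (H : {group gT}) (T : HSet H), I H T -> J H T.

Definition IndCat (gT : finGroupType) : Category.
Proof.
exists (IndexingSystem gT) (@isys_le gT)
  (fun I H T h => h) (fun I J L g f H T h => g H T (f H T h)).
- by move=> *; exact: Prop_irrelevance.
- by move=> *; exact: Prop_irrelevance.
- by move=> *; exact: Prop_irrelevance.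
Defined.

Local Open Scope classical_set_scope.
Local Open Scope group_scope.

(* Equations between operations whose arities agree only propositionally are   *)
(* stated in the total space {n : nat & O n}.                                  *)

Record operad_structure (gT : finGroupType) (O : nat -> Type) := {
  op_G : forall n, gT -> O n -> O n;
  op_S : forall n, O n -> Sigma n -> O n;
  op_id : O 1%N;
  op_comp : forall (k : nat) (j : 'I_k -> nat),
    O k -> (forall i, O (j i)) -> O (\sum_i j i)%N;

  op_G1 : forall n (f : O n), op_G 1 f = f;
  op_GM : forall n g h (f : O n), op_G (g * h) f = op_G g (op_G h f);
  op_S1 : forall n (f : O n), op_S f 1 = f;
  op_SM : forall n (f : O n) s t, op_S f (s * t) = op_S (op_S f s) t;
  op_GS : forall n g (f : O n) s, op_G g (op_S f s) = op_S (op_G g f) s;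

  op_G_id : forall g, op_G g op_id = op_id;
  op_G_comp : forall g k j (c : O k) (d : forall i : 'I_k, O (j i)),
    op_G g (op_comp c d) = op_comp (op_G g c) (fun i => op_G g (d i));

  op_comp1l : forall n (f : O n),
    Tagged O (op_comp op_id (fun _ : 'I_1 => f)) = Tagged O f;
  op_comp1r : forall n (f : O n),
    Tagged O (op_comp f (fun _ : 'I_n => op_id)) = Tagged O f;
  op_compA : forall k (j : 'I_k -> nat) (m : forall i, 'I_(j i) -> nat)
      (c : O k) (d : forall i, O (j i)) (e : forall i l, O (m i l)),
    Tagged O (op_comp (op_comp c d)
                (fun a => e (tagnat.sig1 a) (tagnat.sig2 a))) =
    Tagged O (op_comp c (fun i => op_comp (d i) (e i)));
  op_comp_block_perm : forall k j (c : O k) (d : forall i : 'I_k, O (j i))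
      (s : Sigma k),
    Tagged O (op_comp (op_S c s) (fun i => d (s i))) =
    Tagged O (op_S (op_comp c d) (block_perm j s));
  op_comp_block_sum : forall k j (c : O k) (d : forall i : 'I_k, O (j i))
      (t : forall i, Sigma (j i)),
    op_comp c (fun i => op_S (d i) (t i)) =
    op_S (op_comp c d) (block_sum t) }.

Section OperadNotions.
Variables (gT : finGroupType) (O : nat -> Type) (s : operad_structure gT O).

Definition op_act n (p : gT * Sigma n) (f : O n) : O n :=
  op_S s (op_G s p.1 f) p.2^-1.

Definition fixpts n (Gam : {set gT * Sigma n}) : set (O n) :=
  [set f | forall p, p \in Gam -> op_act p f = f].

Definition Gfixpts n : set (O n) := [set f | forall g, op_G s g f = f].

Definition Sigma_free : Prop :=
  forall n (f : O n) (t : Sigma n), op_S s f t = f -> t = 1.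

End OperadNotions.

Record is_operad_map (gT : finGroupType) (O P : nat -> Type)
    (sO : operad_structure gT O) (sP : operad_structure gT P)
    (phi : forall n, O n -> P n) : Prop := {
  om_G : forall n g (f : O n), phi n (op_G sO g f) = op_G sP g (phi n f);
  om_S : forall n (f : O n) t, phi n (op_S sO f t) = op_S sP (phi n f) t;
  om_id : phi 1%N (op_id sO) = op_id sP;
  om_comp : forall k (j : 'I_k -> nat) (c : O k) (d : forall i, O (j i)),
    phi _ (op_comp sO c d) = op_comp sP (phi k c) (fun i => phi _ (d i)) }.

Lemma is_operad_map_id (gT : finGroupType) O (sO : operad_structure gT O) :
  is_operad_map sO sO (fun _ x => x).
Proof. by split. Qed.

Lemma is_operad_map_comp (gT : finGroupType) O P Q
    (sO : operad_structure gT O) (sP : operad_structure gT P)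
    (sQ : operad_structure gT Q) phi psi :
  is_operad_map sO sP phi -> is_operad_map sP sQ psi ->
  is_operad_map sO sQ (fun n x => psi n (phi n x)).
Proof.
move=> [a1 a2 a3 a4] [b1 b2 b3 b4]; split=> *.
- by rewrite a1 b1.
- by rewrite a2 b2.
- by rewrite a3 b3.
- by rewrite a4 b4.
Qed.

Record GSetOperad (gT : finGroupType) := {
  gso_level :> nat -> Type;
  gso_str : operad_structure gT gso_level }.

Definition GSetOperad_hom gT (O P : GSetOperad gT) : Type :=
  {phi : forall n, O n -> P n | is_operad_map (gso_str O) (gso_str P) phi}.

Definition GSetOperadCat (gT : finGroupType) : Category.
Proof.
exists (GSetOperad gT) (@GSetOperad_hom gT)
  (fun O => exist _ _ (is_operad_map_id (gso_str O)))
  (fun O P Q g f => exist _ _ (is_operad_map_comp (svalP f) (svalP g))).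
- by move=> *; exact: eq_exist.
- by move=> O P [f fP]; exact: eq_exist.
- by move=> O P [f fP]; exact: eq_exist.
Defined.

Definition N_operad gT (O : GSetOperad gT) : Prop :=
  [/\ Sigma_free (gso_str O),
      Gfixpts (gso_str O) (n := 0) !=set0 &
      Gfixpts (gso_str O) (n := 2) !=set0].

Definition NOp (gT : finGroupType) : Category :=
  @full_subcategory (GSetOperadCat gT) (@N_operad gT).

Definition kopen (X : topologicalType) (U : set X) : Prop :=
  forall (K : topologicalType) (u : K -> X),
    compact [set: K] -> hausdorff_space K -> continuous u -> open (u @^-1` U).

Definition compactly_generated (X : topologicalType) : Prop :=
  forall U : set X, kopen U -> open U.

Definition weak_hausdorff (X : topologicalType) : Prop :=
  forall (K : topologicalType) (u : K -> X),
    compact [set: K] -> hausdorff_space K -> continuous u -> closed (range u).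

(* The k-ification of X; products of compactly generated weak Hausdorff spaces *)
(* are the k-ifications of topological products.                               *)
Definition kspace (X : Type) : Type := X.

Section KSpace.
Variable X : topologicalType.
HB.instance Definition _ := Choice.on (kspace X).
Fact kopenT : @kopen X setT.
Proof. by move=> K u _ _ _; rewrite preimage_setT; exact: openT. Qed.
Fact kopenI : setI_closed (@kopen X).
Proof.
move=> U V kU kV K u cK hK cu; rewrite preimage_setI.
by apply: openI; [exact: kU|exact: kV].
Qed.
Fact kopen_bigU (I : Type) (f : I -> set X) :
  (forall i, kopen (f i)) -> kopen (\bigcup_i f i).
Proof.
move=> kf K u cK hK cu; rewrite preimage_bigcup.
by apply: bigcup_open => i _; exact: kf.
Qed.
HB.instance Definition _ :=
  isOpenTopological.Build (kspace X) kopenT kopenI kopen_bigU.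
End KSpace.

(* As [0, 1] is compact Hausdorff, X * [0, 1] needs no k-ification. *)
Definition contractible (R : realType) (X : topologicalType) : Prop :=
  exists (x0 : X) (h : X * R -> X),
    [/\ {within [set: X] `*` `[0%R, 1%R]%classic, continuous h},
        forall x, h (x, 0%R) = x &
        forall x, h (x, 1%R) = x0].

(* Operads in G-spaces; as G is finite and discrete, a continuous G-action is  *)
(* an action by continuous maps.                                               *)

Record GSpaceOperad (gT : finGroupType) := {
  gpo_level :> nat -> topologicalType;
  gpo_str : operad_structure gT (fun n => gpo_level n);
  gpo_cg : forall n, compactly_generated (gpo_level n);
  gpo_wh : forall n, weak_hausdorff (gpo_level n);
  gpo_G_cont : forall n g,
    continuous (op_G gpo_str g : gpo_level n -> gpo_level n);
  gpo_S_cont : forall n (t : Sigma n),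
    continuous ((fun f => op_S gpo_str f t) : gpo_level n -> gpo_level n);
  gpo_comp_cont : forall k (j : 'I_k -> nat),
    continuous
      ((fun p => op_comp gpo_str p.1 p.2) :
        kspace (gpo_level k * prod_topology (fun i => gpo_level (j i)))%type ->
        gpo_level (\sum_i j i)%N) }.

Definition is_cont_operad_map gT (O P : GSpaceOperad gT)
    (phi : forall n, O n -> P n) : Prop :=
  is_operad_map (gpo_str O) (gpo_str P) phi /\ forall n, continuous (phi n).

Definition GSpaceOperad_hom gT (O P : GSpaceOperad gT) : Type :=
  {phi : forall n, O n -> P n | is_cont_operad_map phi}.

Fact is_cont_operad_map_id gT (O : GSpaceOperad gT) :
  @is_cont_operad_map gT O O (fun _ x => x).
Proof. by split=> [|n x]; [exact: is_operad_map_id|exact: cvg_id]. Qed.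

Fact is_cont_operad_map_comp gT (O P Q : GSpaceOperad gT) phi psi :
  @is_cont_operad_map gT O P phi -> @is_cont_operad_map gT P Q psi ->
  @is_cont_operad_map gT O Q (fun n x => psi n (phi n x)).
Proof.
move=> [a ca] [b cb]; split; first exact: is_operad_map_comp a b.
by move=> n x; apply: continuous_comp; [exact: ca|exact: cb].
Qed.

Definition GSpaceOperadCat (gT : finGroupType) : Category.
Proof.
exists (GSpaceOperad gT) (@GSpaceOperad_hom gT)
  (fun O => exist _ _ (is_cont_operad_map_id O))
  (fun O P Q g f => exist _ _ (is_cont_operad_map_comp (svalP f) (svalP g))).
- by move=> *; exact: eq_exist.
- by move=> O P [f fP]; exact: eq_exist.
- by move=> O P [f fP]; exact: eq_exist.
Defined.

Definition graph_subgroup (gT : finGroupType) n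
    (Gam : {group gT * Sigma n}) : Prop :=
  forall t : Sigma n, (1, t) \in Gam -> t = 1.

Definition Ninf_operad (R : realType) gT (O : GSpaceOperad gT) : Prop :=
  [/\ Sigma_free (gpo_str O),
      forall n (Gam : {group gT * Sigma n}), graph_subgroup Gam ->
        fixpts (gpo_str O) Gam = set0 \/
        contractible R (fixpts (gpo_str O) Gam),
      Gfixpts (gpo_str O) (n := 0) !=set0 &
      Gfixpts (gpo_str O) (n := 2) !=set0].

Definition NinfOp (R : realType) (gT : finGroupType) : Category :=
  @full_subcategory (GSpaceOperadCat gT) (@Ninf_operad R gT).

Record SymSeq (gT : finGroupType) := {
  ss_level :> nat -> Type;
  ss_act : forall n, gT * Sigma n -> ss_level n -> ss_level n;
  ss_act1 : forall n (x : ss_level n), ss_act 1 x = x;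
  ss_actM : forall n (p q : gT * Sigma n) (x : ss_level n),
    ss_act (p * q) x = ss_act p (ss_act q x) }.

Definition is_symseq_map gT (S T : SymSeq gT) (phi : forall n, S n -> T n) :
  Prop := forall n p (x : S n), phi n (ss_act p x) = ss_act p (phi n x).

Definition SymSeq_hom gT (S T : SymSeq gT) : Type :=
  {phi : forall n, S n -> T n | is_symseq_map phi}.

Fact is_symseq_map_id gT (S : SymSeq gT) :
  @is_symseq_map gT S S (fun _ x => x).
Proof. by []. Qed.

Fact is_symseq_map_comp gT (S T U : SymSeq gT) phi psi :
  @is_symseq_map gT S T phi -> @is_symseq_map gT T U psi ->
  @is_symseq_map gT S U (fun n x => psi n (phi n x)).
Proof. by move=> a b n p x; rewrite a b. Qed.

Definition SymSeqCat (gT : finGroupType) : Category.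
Proof.
exists (SymSeq gT) (@SymSeq_hom gT)
  (fun S => exist _ _ (@is_symseq_map_id gT S))
  (fun S T U g f => exist _ _ (@is_symseq_map_comp gT S T U _ _ (svalP f) (svalP g))).
- by move=> *; exact: eq_exist.
- by move=> S T [f fP]; exact: eq_exist.
- by move=> S T [f fP]; exact: eq_exist.
Defined.

Definition op_symseq gT (O : GSetOperad gT) : SymSeq gT.
Proof.
refine (@Build_SymSeq gT O (fun n => @op_act gT O (gso_str O) n) _ _).
- by move=> n x; rewrite /op_act op_G1 invg1 op_S1.
- by move=> n p q x; rewrite /op_act op_GM op_GS invMg op_SM.
Defined.

Fact forgetful_map gT (O P : GSetOperad gT) (f : GSetOperad_hom O P) :
  @is_symseq_map gT (op_symseq O) (op_symseq P) (sval f).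
Proof.
by move=> n p x; rewrite /= /op_act (om_S (svalP f)) (om_G (svalP f)).
Qed.

Definition forgetful (gT : finGroupType) :
  Functor (GSetOperadCat gT) (SymSeqCat gT).
Proof.
exists (@op_symseq gT) (fun O P f => exist _ _ (@forgetful_map gT O P f)).
- by move=> *; exact: eq_exist.
- by move=> *; exact: eq_exist.
Defined.

(* The coproduct of the orbits (G x Sigma_(lev b)) / Gam b, each placed in     *)
(* level lev b                                                                 *)
Section OrbitSeq.
Variables (gT : finGroupType) (B : Type) (lev : B -> nat).
Variable Gam : forall b, {group gT * Sigma (lev b)}.

Inductive orbit_seq : nat -> Type :=
  OrbitSeq b of {C | C \in lcosets (Gam b) [set: gT * Sigma (lev b)]%SET} :
    orbit_seq (lev b).

Fact orbit_seq_stable b (p : gT * Sigma (lev b))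
    (C : {C | C \in lcosets (Gam b) [set: gT * Sigma (lev b)]%SET}) :
  p *: val C \in lcosets (Gam b) [set: gT * Sigma (lev b)]%SET.
Proof.
case: C => C /= /lcosetsP[x _ ->].
by rewrite -lcosetM; apply/lcosetsP; exists (p * x); rewrite ?finset.in_setT.
Qed.

Definition orbit_seq_act n (p : gT * Sigma n) (x : orbit_seq n) : orbit_seq n :=
  match x in orbit_seq n return gT * Sigma n -> orbit_seq n with
  | OrbitSeq b C => fun p => OrbitSeq (exist _ (p *: val C) (orbit_seq_stable p C))
  end p.

Definition orbit_symseq : SymSeq gT.
Proof.
refine (@Build_SymSeq gT orbit_seq orbit_seq_act _ _).
- move=> n [b C]; congr OrbitSeq; apply: val_inj; exact: lcoset1.
- move=> n p q x; case: x p q => b C p q /=.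
  by congr OrbitSeq; apply: val_inj; exact: lcosetM.
Defined.
End OrbitSeq.

(* The symmetric sequence S_T; an indexed set of finite G-subgroup actions is a *)
(* family T : J -> {H : {group gT} & HSet H}.                                   *)
Section Generators.
Variables (gT : finGroupType) (J : Type) (T : J -> {H : {group gT} & HSet H}).

Variant gen_index : Type := GenNullary | GenBinary | GenAction of J.

Definition gen_level (b : gen_index) : nat :=
  match b with
  | GenNullary => 0
  | GenBinary => 2
  | GenAction al => #|tagged (T al)|
  end.

Definition gen_stabilizer (b : gen_index) : {group gT * Sigma (gen_level b)} :=
  match b with
  | GenNullary => setX_group [group of [set: gT]%SET] 1%G
  | GenBinary => setX_group [group of [set: gT]%SET] 1%G
  | GenAction al => gammaT (tagged (T al))
  end.

Definition gen_symseq : SymSeq gT := orbit_symseq gen_stabilizer.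

End Generators.

Definition freeN (gT : finGroupType) (F : LeftAdjoint (forgetful gT)) (J : Type)
    (T : J -> {H : {group gT} & HSet H}) : GSetOperad gT := F (gen_symseq T).

Definition nontrivial_orbit (gT : finGroupType) (I : IndexingSystem gT)
    (HK : {group gT} * {group gT}) : Prop :=
  [/\ HK.2 \subset HK.1, HK.2 <> HK.1 & I HK.1 (hs_orbit HK.1 HK.2)].

Definition nontrivial_orbits (gT : finGroupType) (I : IndexingSystem gT)
    (HK : {HK | nontrivial_orbit I HK}) : {H : {group gT} & HSet H} :=
  Tagged _ (hs_orbit (sval HK).1 (sval HK).2).

(* Finitely many orbits under the actions of the finite groups G x Sigma_n *)
Definition finitely_generated (gT : finGroupType) (S : SymSeq gT) : Prop :=
  exists (B : finType) (y : B -> {n : nat & S n}), forall n (x : S n),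
    exists b p, Tagged S x = Tagged S (ss_act p (tagged (y b))).

Definition finitely_generated_free (gT : finGroupType)
    (F : LeftAdjoint (forgetful gT)) (O : GSetOperadCat gT) : Prop :=
  exists2 S : SymSeq gT, finitely_generated S & isomorphic O (F S).

Lemma Tagged_inj (O : nat -> Type) n (x y : O n) :
  Tagged O x = Tagged O y -> x = y.
Proof.
by move=> /(congr1 (fun v => @tagged_as _ O (Tagged O x) v)); rewrite !tagged_asE.
Qed.

Section Admissible.
Variables (gT : finGroupType) (O : nat -> Type) (s : operad_structure gT O).

Definition admissible (H : {group gT}) (T : HSet H) : Prop :=
  fixpts s (gammaT T) !=set0.

Definition presents (H : {group gT}) (T : HSet H) n (e : 'I_n -> T) (f : O n) :=
  bijective e /\ forall a (t : Sigma n),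
    (forall i, e (t i) = hs_act a (e i)) -> op_G s (sgval a) f = op_S s f t.

Lemma presents_perm (H : {group gT}) (T : HSet H) n (e : 'I_n -> T) f :
  presents e f -> forall a, exists2 t : Sigma n,
    forall i, e (t i) = hs_act a (e i) & op_G s (sgval a) f = op_S s f t.
Proof.
case=> -[e' eK e'K] ef a.
have inj : injective (fun i => e' (hs_act a (e i))).
  move=> i i' /(congr1 e); rewrite !e'K => /(can_inj (hs_actK a)).
  exact: (can_inj eK).
have tE i : e (mk_sigma inj i) = hs_act a (e i) by rewrite mk_sigmaE e'K.
by exists (mk_sigma inj) => //; exact: ef.
Qed.

Lemma admissibleP (H : {group gT}) (T : HSet H) :
  admissible T <-> exists n (e : 'I_n -> T) (f : O n), presents e f.
Proof.
split=> [[f ff]|[n [e [f [e_bij ef]]]]].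
  exists #|T|, enum_val, f; split; first exact: enum_val_bij.
  move=> a t te.
  have -> : t = hs_perm T a.
    apply: sigmaP => i; apply: enum_val_inj.
    by rewrite te mk_sigmaE enum_rankK.
  have := ff (sgval a, hs_perm T a); rewrite /op_act /=.
  move=> {2}<-; last exact: imset_f.
  by rewrite -op_SM mulVg op_S1.
have en : n = #|T| by rewrite -(bij_eq_card e_bij) card_ord.
subst n; case: (e_bij) => e' eK e'K.
have inj : injective (fun i : 'I_#|T| => e' (enum_val i)).
  by move=> i i' /(congr1 e); rewrite !e'K => /enum_val_inj.
pose p := mk_sigma inj.
have pE i : e (p i) = enum_val i by rewrite mk_sigmaE e'K.
exists (op_S s f p) => _ /imsetP[a _ ->]; rewrite /op_act /=.
rewrite op_GS (ef a (p * hs_perm T a * p^-1)); last first.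
  move=> i; rewrite 2!sigmaM pE mk_sigmaE enum_rankK -pE.
  by rewrite sigmaKV.
by rewrite -!op_SM !mulgA mulgKV mulgK.
Qed.

Lemma eq_op_comp k (j j' : 'I_k -> nat) (c : O k) (d : forall i, O (j i))
    (d' : forall i, O (j' i)) :
  (forall i, Tagged O (d i) = Tagged O (d' i)) ->
  Tagged O (op_comp s c d) = Tagged O (op_comp s c d').
Proof.
move=> dd'; have jj' : j = j' by apply/funext => i; exact: (congr1 tag (dd' i)).
subst j'; suff -> : d = d' by [].
apply: functional_extensionality_dep => i.
exact: Tagged_inj (dd' i).
Qed.

Lemma presents_comp (H : {group gT}) (B T : HSet H) k (eB : 'I_k -> B) (x : O k)
    (j : 'I_k -> nat) (y : forall i, O (j i)) (f : forall i, 'I_(j i) -> T) :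
  presents eB x ->
  (forall i l i' l', f i l = f i' l' -> i = i' /\ l = l' :> nat) ->
  (forall z, exists i l, f i l = z) ->
  (forall a i i', eB i' = hs_act a (eB i) -> exists t : Sigma (j i'),
    Tagged O (op_G s (sgval a) (y i)) = Tagged O (op_S s (y i') t) /\
    forall (l : 'I_(j i)) (l' : 'I_(j i')), l = l' :> nat ->
      f i' (t l') = hs_act a (f i l)) ->
  presents (fun b : 'I_(\sum_i j i) => f (tagnat.sig1 b) (tagnat.sig2 b))
    (op_comp s x y).
Proof.
move=> xB finj fsur fact.
have eR i l : f (tagnat.sig1 (tagnat.Rank i l)) (tagnat.sig2 (tagnat.Rank i l))
              = f i l.
  by rewrite /tagnat.sig1 /tagnat.sig2 tagnat.rankK.
have einj : injective
    (fun b : 'I_(\sum_i j i) => f (tagnat.sig1 b) (tagnat.sig2 b)).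
  move=> b b' /finj[e1 e2]; apply: val_inj.
  rewrite -(tagnat.sig2K b) -(tagnat.sig2K b'); apply/eqP.
  by rewrite tagnat.eq_Rank; apply/andP; split; apply/eqP.
have /fin_all_exists[g gK] : forall z, exists b : 'I_(\sum_i j i),
    f (tagnat.sig1 b) (tagnat.sig2 b) = z.
  by move=> z; have [i [l <-]] := fsur z; exists (tagnat.Rank i l).
split; first by exists g => // b; apply: einj; rewrite gK.
move=> a t tE; have [u uE xu] := presents_perm xB a.
have /fin_all_exists[v vP] : forall i', exists w : Sigma (j i'),
    let i := (u^-1 : Sigma k)%g i' in
    Tagged O (op_G s (sgval a) (y i)) = Tagged O (op_S s (y i') w) /\
    forall (l : 'I_(j i)) (l' : 'I_(j i')), l = l' :> nat ->
      f i' (w l') = hs_act a (f i l).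
  by move=> i'; apply: fact; rewrite -uE sigmaKV.
pose d i := op_S s (y i) (v i).
have -> : op_G s (sgval a) (op_comp s x y) =
    op_S s (op_S s (op_comp s x y) (block_sum v)) (block_perm j u).
  apply: (@Tagged_inj O); rewrite -op_comp_block_sum -op_comp_block_perm op_G_comp xu.
  by apply: eq_op_comp => i; have [+ _] := vP (u i); rewrite sigmaK.
rewrite -op_SM; congr op_S.
apply: sigmaP => b; apply: einj; rewrite tE sigmaM !mk_sigmaE.
rewrite /block_sum_fun eR /block_perm_fun.
set b' := cast_ord _ b.
rewrite /tagnat.sig1 /tagnat.sig2 tagnat.rankK /=.
have bb' : b = b' :> nat by [].
move: bb'; rewrite -[b' in _ = nat_of_ord b']tagnat.sigK -(tagnat.sigK b).
case: (tagnat.sig b') => i l; case: (tagnat.sig b) => i0 l0 /=.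
rewrite tagnat.rankK /= => bb'.
have ju i1 : j (u i1) = j i1.
  have [+ _] := vP (u i1); rewrite sigmaK => /(congr1 tag) /=.
  by move->.
have [e1 e2] : i0 = i /\ l0 = l :> nat.
  have : tagnat.Rank i0 l0 = tagnat.Rank i (cast_ord (ju i) l) :> nat.
    rewrite [LHS]bb' [LHS]tagnat.rankEsum [RHS]tagnat.rankEsum /=; congr addn.
    by apply: eq_bigr => i1 _; rewrite ju.
  by move/eqP; rewrite tagnat.eq_Rank => /andP[/eqP ? /eqP ?]; split.
have [_ +] := vP (u i); rewrite sigmaK => h.
by clear bb'; subst i0; apply: h.
Qed.

End Admissible.

Section Closure.
Variables (gT : finGroupType) (O : nat -> Type) (s : operad_structure gT O).
Hypotheses (nullary : Gfixpts s (n := 0) !=set0)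
  (binary : Gfixpts s (n := 2) !=set0).

Lemma Gfixpts_nonempty n : Gfixpts s (n := n) !=set0.
Proof.
elim: n => [//|n [f ff]]; have [c cf] := binary.
pose j (i : 'I_2) := if i == ord0 then 1%N else n.
have /fin_all_exists[d df] (i : 'I_2) :
    exists d : O (j i), forall g, op_G s g d = d.
  rewrite /j; case: ifP => _; last by exists f.
  by exists (op_id s) => g; exact: op_G_id.
have <- : (\sum_i j i)%N = n.+1 by rewrite big_ord_recl big_ord1.
exists (op_comp s c d) => g; rewrite op_G_comp cf; congr op_comp.
by apply: functional_extensionality_dep => i; rewrite df.
Qed.

Lemma admissible_trivial (H : {group gT}) (T : HSet H) :
  hs_trivial T -> admissible s T.
Proof.
move=> trT; have [f ff] := Gfixpts_nonempty #|T|.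
apply/admissibleP; exists #|T|, enum_val, f; split; first exact: enum_val_bij.
move=> a t te; suff -> : t = 1 by rewrite op_S1.
by apply: sigmaP => i; apply: enum_val_inj; rewrite te trT sigma1.
Qed.

Lemma admissible_iso (H : {group gT}) (S T : HSet H) :
  hs_iso S T -> admissible s S -> admissible s T.
Proof.
case=> phi phi_bij phiE /admissibleP[n [e [f [e_bij ef]]]].
apply/admissibleP; exists n, (phi \o e), f; split; first exact: bij_comp.
move=> a t te; apply: ef => i; apply: (bij_inj phi_bij).
by rewrite phiE; exact: te.
Qed.

Lemma admissible_res (H K : {group gT}) (sKH : K \subset H) (T : HSet H) :
  admissible s T -> admissible s (hs_res sKH T).
Proof.
case/admissibleP=> n [e [f [e_bij ef]]].
apply/admissibleP; exists n, e, f; split=> // a t te.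
by rewrite -(subg_inclE sKH a); apply: ef.
Qed.

Lemma admissible_conj (H : {group gT}) (a : gT) (T : HSet H) :
  admissible s T -> admissible s (hs_conj a T).
Proof.
case/admissibleP=> n [e [f [e_bij ef]]].
apply/admissibleP; exists n, e, (op_G s a f); split=> // x t te.
by rewrite -op_GM conjgC op_GM -subg_conjE (ef _ t) ?op_GS.
Qed.

Fact ord_bool (b : bool) (l : 'I_b) : b.
Proof. by case: b l => // -[]. Qed.

Lemma admissible_sub (H : {group gT}) (T : HSet H) (U : {set T})
  (stU : hs_stable U) : admissible s T -> admissible s (hs_sub stU).
Proof.
case/admissibleP=> n [e [f pf]]; have [c cf] := nullary.
pose y (b : bool) : O b := if b return O b then op_id s else c.
have yf b g : op_G s g (y b) = y b by case: b => /=; rewrite ?op_G_id ?cf.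
pose phi i (l : 'I_(e i \in U)) : hs_sub stU := exist _ (e i) (ord_bool l).
apply/admissibleP; do 3 eexists.
apply: (presents_comp (y := fun i => y (e i \in U)) (f := phi) pf).
- have l0 (b : bool) (l : 'I_b) : l = 0%N :> nat by case: b l => -[[|m] lt].
  move=> i l i' l' /(congr1 sval) /= /(bij_inj pf.1) ii'; split=> //.
  by rewrite !l0.
- move=> [z zU]; have [e' eK e'K] := pf.1.
  have e'U : e (e' z) \in U by rewrite e'K.
  have l0 : (0 < (e (e' z) \in U))%N by rewrite e'U.
  by exists (e' z), (Ordinal l0); apply: val_inj; rewrite /= e'K.
- move=> a i i' ii'; exists 1; rewrite op_S1 yf; split.
    suff -> : (e i \in U) = (e i' \in U) by [].
    rewrite ii'; apply/idP/idP => [|aU]; first exact: (stU _ _).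
    by rewrite -(hs_actK a (e i)); exact: (stU _ _).
  by move=> l l' ll'; apply: val_inj; rewrite /= ii'.
Qed.

Definition hs_bool (H : {group gT}) : HSet H.
Proof. by refine (@Build_HSet gT H bool (fun _ b => b) _ _). Defined.

Lemma admissible_sum (H : {group gT}) (S T : HSet H) :
  admissible s S -> admissible s T -> admissible s (hs_sum S T).
Proof.
case/admissibleP=> m [eS [x pS]] /admissibleP[n [eT [y pT]]].
have [c cf] := binary.
pose eB (i : 'I_2) : hs_bool H := i == ord0.
have pB : presents s eB c.
  split.
    exists (fun b : bool => if b then ord0 else ord_max).
      by move=> i; apply: val_inj; case: i => [[|[|k]] ?].
    by case.
  move=> a t te; suff -> : t = 1 by rewrite op_S1 cf.
  apply: sigmaP => i; rewrite sigma1; have := te i.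
  rewrite /eB /=; move: (t i) => u; clear te.
  by case: u i => [[|[|k]] ?] [[|[|k']] ?] //= _; apply: val_inj.
pose j (b : bool) := if b then m else n.
pose d (b : bool) : O (j b) := if b return O (j b) then x else y.
pose phi (b : bool) : 'I_(j b) -> hs_sum S T :=
  if b return 'I_(j b) -> (S + T)%type then (fun l => inl (eS l))
  else (fun l => inr (eT l)).
apply/admissibleP; do 3 eexists.
apply: (presents_comp (j := fun i => j (eB i)) (y := fun i => d (eB i))
  (f := fun i => @phi (eB i)) pB).
- move=> i l i' l' e.
  have [eb el] : eB i = eB i' /\ l = l' :> nat.
    case: (eB i) l e => l; case: (eB i') l' => l' //= -[].
      by move/(bij_inj pS.1) ->.
    by move/(bij_inj pT.1) ->.
  by split=> //; apply: (bij_inj pB.1).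
- have [[eS' _ eSK] _] := pS; have [[eT' _ eTK] _] := pT.
  have [eB' _ eBK] := pB.1.
  suff h b z : (exists l, @phi b l = z) -> exists i l, @phi (eB i) l = z.
    by case=> z; [apply: (h true); exists (eS' z)|apply: (h false); exists (eT' z)];
      rewrite /= ?eSK ?eTK.
  by move=> hb; exists (eB' b); rewrite eBK.
- move=> a i i' /= ->; case: (eB i).
    have [t te xt] := presents_perm pS a; exists t; split; first by rewrite xt.
    by move=> l l' /ord_inj <-; rewrite /= te.
  have [t te yt] := presents_perm pT a; exists t; split; first by rewrite yt.
  by move=> l l' /ord_inj <-; rewrite /= te.
Qed.

Lemma admissible_ind (H K : {group gT}) (T : HSet K) : K \subset H ->
  admissible s T -> admissible s (hs_orbit H K) -> admissible s (hs_ind H T).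
Proof.
move=> sKH /admissibleP[n [e [f pT]]] /admissibleP[k [eB [x pB]]].
have /fin_all_exists[r rE] (i : 'I_k) :
    exists r : subg_of H, val (eB i) = sgval r *: K.
  case: (eB i) => C /= /lcosetsP[h hH ->].
  by exists (subg H h); rewrite subgK.
have [e' eK e'K] := pT.1.
have cP i l : ind_class (r i, e l) \in ind_classes H T by apply: imset_f.
pose phi i (l : 'I_n) : hs_ind H T := exist _ (ind_class (r i, e l)) (cP i l).
have inclV (a : subg_of K) : subg_incl H a^-1 = (subg_incl H a)^-1.
  by apply: (mulIg (subg_incl H a)); rewrite mulVg -subg_inclM // mulVg subg_incl1.
have coset_incl (h : subg_of H) (a : subg_of K) :
    sgval (h * subg_incl H a) *: K = sgval h *: K.
  by rewrite /= lcosetM subg_inclE // lcoset_id ?subgP.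
have classE h (b : subg_of K) t :
    ind_class (h * subg_incl H b, t) = ind_class (h, hs_act b t) :> {set _ * T}.
  apply/finset.setP => q; apply/imsetP/imsetP => [[a _ ->]|[a _ ->]].
    exists (a * b^-1) => //=; rewrite -hs_actM mulgKV; congr (_, _).
    by rewrite subg_inclM // inclV invMg invgK mulgA.
  exists (a * b) => //=; rewrite hs_actM; congr (_, _).
  by rewrite subg_inclM // invMg mulgA mulgK.
apply/admissibleP; do 3 eexists.
apply: (presents_comp (j := fun=> n) (y := fun i => op_G s (sgval (r i)) f)
  (f := phi) pB).
- move=> i l i' l' /(congr1 sval) /= ll'.
  have : (r i, e l) \in ind_class (r i', e l').
    by rewrite -ll'; apply/imsetP; exists 1; rewrite //= (subg_incl1 sKH) invg1 mulg1 hs_act1.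
  case/imsetP=> a _ /= [ra ea].
  have ii' : i = i'.
    by apply: (bij_inj pB.1); apply: val_inj; rewrite !rE ra -inclV coset_incl.
  split=> //; rewrite (bij_inj pT.1 (_ : e l = e l')) // ea.
  suff -> : a = 1 by rewrite hs_act1.
  suff a1 : subg_incl H a = 1.
    by apply: val_inj; change (sgval a = 1); rewrite -(subg_inclE sKH) a1.
  apply: (inj_comp (mulgI (r i')) (@invg_inj _)).
  by rewrite /= -ra ii' invg1 mulg1.
- case=> C /= CC; case/imsetP: (CC) => -[h t] _ eC.
  have hK : sgval h *: K \in lcosets K H.
    by apply/lcosetsP; exists (sgval h); rewrite ?subgP.
  have [eB' _ eBK] := pB.1; pose C0 : hs_orbit H K :=
    exist (fun C : {set gT} => C \in lcosets K H) _ hK.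
  pose i := eB' C0.
  have ri : sgval (r i) *: K = sgval h *: K by rewrite -rE eBK.
  have kK : (sgval (r i))^-1 * sgval h \in K.
    by rewrite -mem_lcoset ri lcoset_refl.
  have hE : h = r i * subg_incl H (subg K ((sgval (r i))^-1 * sgval h)).
    by apply: val_inj; rewrite /= subg_inclE // subgK // mulKVg.
  exists i, (e' (hs_act (subg K ((sgval (r i))^-1 * sgval h)) t)).
  by apply: val_inj; rewrite /= eC e'K -classE -hE.
- move=> a i i' ii'.
  have cosE : sgval (r i') *: K = sgval (a * r i) *: K.
    by rewrite -rE ii' /= rE -lcosetM.
  have kK : (sgval (r i'))^-1 * sgval (a * r i) \in K.
    by rewrite -mem_lcoset cosE lcoset_refl.
  pose b := subg K ((sgval (r i'))^-1 * sgval (a * r i)).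
  have bE : a * r i = r i' * subg_incl H b.
    by apply: val_inj; rewrite /= subg_inclE // subgK // mulKVg.
  have [t te ft] := presents_perm pT b; exists t; split.
    congr Tagged; rewrite -op_GM -op_GS -ft -op_GM; congr op_G.
    by rewrite -(subg_inclE sKH b); exact: (congr1 val bE).
  move=> l l' /ord_inj <-; apply: val_inj => /=.
  by rewrite ind_act_class /= bE classE te.
Qed.

Definition admissible_sets : IndexingSystem gT :=
  {| isys_trivial := admissible_trivial;
     isys_iso := admissible_iso;
     isys_res := admissible_res;
     isys_conj := admissible_conj;
     isys_sub := admissible_sub;
     isys_sum := admissible_sum;
     isys_ind := admissible_ind |}.

End Closure.

Lemma admissible_map (gT : finGroupType) (O P : nat -> Type)
    (sO : operad_structure gT O) (sP : operad_structure gT P) phi :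
  is_operad_map sO sP phi ->
  forall (H : {group gT}) (T : HSet H), admissible sO T -> admissible sP T.
Proof.
move=> om H T [f ff]; exists (phi _ f) => p pT.
by rewrite /op_act -(om_G om) -(om_S om) -[in RHS](ff p pT).
Qed.

Fact N_operad_nullary gT (O : GSetOperad gT) :
  N_operad O -> Gfixpts (gso_str O) (n := 0) !=set0.
Proof. by case. Qed.

Fact N_operad_binary gT (O : GSetOperad gT) :
  N_operad O -> Gfixpts (gso_str O) (n := 2) !=set0.
Proof. by case. Qed.

Definition A_N_ob (gT : finGroupType) (O : NOp gT) : IndexingSystem gT :=
  admissible_sets (N_operad_nullary (svalP O)) (N_operad_binary (svalP O)).

Fact A_N_mor (gT : finGroupType) (O P : NOp gT) (f : mor O P) :
  isys_le (A_N_ob O) (A_N_ob P).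
Proof. exact: (admissible_map (svalP f)). Qed.

Definition A_N (gT : finGroupType) : Functor (NOp gT) (IndCat gT).
Proof.
exists (@A_N_ob gT) (fun O P f => A_N_mor f).
- by move=> O; exact: (@Prop_irrelevance (isys_le _ _)).
- by move=> O P Q g f; exact: (@Prop_irrelevance (isys_le _ _)).
Defined.

Fact Ninf_operad_nullary (R : realType) gT (O : GSpaceOperad gT) :
  Ninf_operad R O -> Gfixpts (gpo_str O) (n := 0) !=set0.
Proof. by case. Qed.

Fact Ninf_operad_binary (R : realType) gT (O : GSpaceOperad gT) :
  Ninf_operad R O -> Gfixpts (gpo_str O) (n := 2) !=set0.
Proof. by case. Qed.

Definition A_Ninf_ob (R : realType) (gT : finGroupType) (O : NinfOp R gT) :
  IndexingSystem gT :=
  admissible_sets (Ninf_operad_nullary (svalP O)) (Ninf_operad_binary (svalP O)).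

Fact A_Ninf_mor (R : realType) (gT : finGroupType) (O P : NinfOp R gT)
  (f : mor O P) : isys_le (A_Ninf_ob O) (A_Ninf_ob P).
Proof. exact: (admissible_map (svalP f).1). Qed.

Definition A_Ninf (R : realType) (gT : finGroupType) :
  Functor (NinfOp R gT) (IndCat gT).
Proof.
exists (@A_Ninf_ob R gT) (fun O P f => A_Ninf_mor f).
- by move=> O; exact: (@Prop_irrelevance (isys_le _ _)).
- by move=> O P Q g f; exact: (@Prop_irrelevance (isys_le _ _)).
Defined.

(* Main.v *)
(** The indexing system of the free operad on S_O(I) contains I because every
    set in I is a coproduct of orbits in I, each of which is trivial or
    stabilizes a generator.  For the reverse inclusion and for freeness of the
    symmetric group actions, it suffices to map the free operad to some
    Sigma-free operad with indexing system at most I, since an operad map only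
    enlarges stabilizers.  That operad consists of trees in which the children
    of a node are the points of a finite set of subsets of G whose
    stabilizer-set is in I: a tree fixed by H fibers its leaves over the
    children of its root, and induction on the tree applies to the fibers.

    An N operad O becomes an N-infinity operad by replacing each O(n) by the
    right-continuous functions [0,1) -> O(n), with f and g at distance the
    measure of the set where they differ (Hartman and Mycielski).  This preserves
    finite products and fixed points, and a function is contracted to a constant
    by overwriting its values on [0,t). *)
From HB Require Import structures.
From mathcomp Require Import all_boot all_order all_fingroup all_algebra.
From mathcomp Require Import all_classical reals constructive_ereal ereal.
From mathcomp Require Import topology normedtype measure lebesgue_measure.
From mathcomp Require Import zify.
Require Import Defs.
Set Implicit Arguments.
Unset Strict Implicit.
Unset Printing Implicit Defensive.

Import GroupScope Order.TTheory GRing.Theory Num.Theory.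
Import numFieldNormedType.Exports.
Local Open Scope group_scope.

(** * Arities of composites *)

Section Arities.
Variables (k : nat) (j : 'I_k -> nat).

(** [tagnat.rank] and [tagnat.sig] are inverse bijections, so the sum reindexes over pairs. The
    predicate makes it possible to sum over the letters before a given one. *)
Lemma sum_blocks (F : forall i, 'I_(j i) -> nat) (P : forall i, pred 'I_(j i)) :
  (\sum_(a < \sum_i j i | P (tagnat.sig1 a) (tagnat.sig2 a))
      F (tagnat.sig1 a) (tagnat.sig2 a) =
   \sum_i \sum_(l < j i | P i l) F i l)%N.
Proof.
rewrite sig_big_dep (reindex_onto tagnat.rank tagnat.sig) /=.
  apply: eq_big => [[i l]|[i l] _].
    by rewrite tagnat.rankK eqxx andbT /tagnat.sig1 /tagnat.sig2 tagnat.rankK.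
  by rewrite /tagnat.sig1 /tagnat.sig2 tagnat.rankK.
by move=> a _; rewrite tagnat.sigK.
Qed.

Lemma ltn_Rank i (l : 'I_(j i)) i' (l' : 'I_(j i')) :
  (tagnat.Rank i' l' < tagnat.Rank i l)%N =
  ((i' < i) || (i' == i) && (l' < l))%N.
Proof.
pose T i := 'I_(j i).
have -> : (tagnat.Rank i' l' < tagnat.Rank i l)%N =
    ((i' <= i) && ((i <= i') ==> (l' < tagged_as (Tagged T l') (Tagged T l))))%N.
  exact: (tagnat.lt_rank (Tagged T l') (Tagged T l)).
case: (eqVneq i' i) l' => [->|ne] l'; last by rewrite -val_eqE /= in ne; lia.
by rewrite tagged_asE leqnn ltnn.
Qed.

(** A rank counts the letters that come before. On the left the blocks before [(i, l)] are counted
    in one lexicographic sum; on the right, first those with smaller first index, then those with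
    first index [i]. The type of [x'] mentions the indices recovered from a rank, hence the separate
    variable. *)
Lemma Rank_assoc (m : forall i, 'I_(j i) -> nat) i (l : 'I_(j i)) (x : 'I_(m i l))
    (x' : 'I_(m (tagnat.sig1 (tagnat.Rank i l)) (tagnat.sig2 (tagnat.Rank i l)))) :
  x' = x :> nat ->
  tagnat.Rank (p_ := fun a => m (tagnat.sig1 a) (tagnat.sig2 a)) (tagnat.Rank i l) x' =
  tagnat.Rank (p_ := fun i => \sum_l m i l)%N i (tagnat.Rank l x) :> nat.
Proof.
move=> xx'; rewrite [LHS]tagnat.RankEsum [RHS]tagnat.RankEsum.
rewrite [tagnat.Rank l x : nat]tagnat.RankEsum xx' addnA; congr addn.
have lt_a (a : 'I_(\sum_i j i)) : (a < tagnat.Rank i l)%N = ((tagnat.sig1 a < i) ||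
    (tagnat.sig1 a == i) && (tagnat.sig2 a < l))%N.
  by rewrite -ltn_Rank tagnat.sig2K.
rewrite (eq_bigl _ _ lt_a).
rewrite (sum_blocks m (fun i' l' => (i' < i) || (i' == i) && (l' < l))%N).
rewrite (bigID (fun i' : 'I_k => i' < i)%N) /=; congr addn.
  by apply: eq_bigr => i' lt; under eq_bigl => l' do rewrite lt.
rewrite (bigD1 i) ?ltnn //= [X in (_ + X)%N]big1 ?addn0; last first.
  move=> i' /andP[/negPf lt /negPf ne]; apply: big_pred0 => l'.
  by rewrite lt ne.
by rewrite eqxx.
Qed.

End Arities.

Lemma sum_ord1 (n : nat) : (\sum_(i < 1) n)%N = n.
Proof. by rewrite big_ord1. Qed.

Lemma sum_ord_const1 (n : nat) : (\sum_(i < n) 1)%N = n.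
Proof. by rewrite sum1_card card_ord. Qed.

Lemma sum_sum_blocks k (j : 'I_k -> nat) (m : forall i, 'I_(j i) -> nat) :
  (\sum_(a < \sum_i j i) m (tagnat.sig1 a) (tagnat.sig2 a) =
   \sum_i \sum_l m i l)%N.
Proof. exact: (sum_blocks m (fun=> xpredT)). Qed.

Lemma Rank_ord1 (n : nat) (i : 'I_1) (l : 'I_n) :
  tagnat.Rank (p_ := fun=> n) i l = l :> nat.
Proof. by rewrite tagnat.RankEsum ord1 big_pred0. Qed.

Lemma Rank_const1 (n : nat) (i : 'I_n) (l : 'I_1) :
  tagnat.Rank (p_ := fun=> 1%N) i l = i :> nat.
Proof.
rewrite tagnat.RankEsum ord1 addn0 -(big_ord_widen _ (fun=> 1%N)) ?sum_ord_const1 //.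
exact: ltnW.
Qed.

(** * The free operad *)

Lemma sval_ext (A : Type) (P : A -> Prop) (x y : {a | P a}) :
  sval x = sval y -> x = y.
Proof. by case: x y => a ? [b ?] /= ab; exact: eq_exist. Qed.

Lemma eq_op_comp_fun gT O (s : operad_structure gT O) k (j : 'I_k -> nat)
    (c : O k) (d d' : forall i, O (j i)) :
  (forall i, d i = d' i) -> op_comp s c d = op_comp s c d'.
Proof. by move=> dd'; congr op_comp; exact: functional_extensionality_dep. Qed.

Section FreeOperad.
Variables (gT : finGroupType) (S : SymSeq gT).

Inductive fterm : nat -> Type :=
  | FGen n of S n : fterm n
  | FG n of gT & fterm n : fterm n
  | FS n of fterm n & Sigma n : fterm n
  | FId : fterm 1
  | FComp k (j : 'I_k -> nat) of fterm k & (forall i, fterm (j i)) :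
      fterm (\sum_i j i)%N.

Section Eval.
Variables (P : GSetOperad gT) (phi : SymSeq_hom S (op_symseq P)).

Fixpoint feval n (t : fterm n) : P n :=
  match t with
  | FGen n x => sval phi n x
  | FG n g t => op_G (gso_str P) g (feval t)
  | FS n t s => op_S (gso_str P) (feval t) s
  | FId => op_id (gso_str P)
  | FComp k j c d => op_comp (gso_str P) (feval c) (fun i => feval (d i))
  end.

End Eval.

(* Identifying terms with the same value in every operad makes the operad axioms *)
(* hold in the quotient because they hold in every operad.                       *)
Definition feq n (t u : fterm n) : Prop :=
  forall (P : GSetOperad gT) (phi : SymSeq_hom S (op_symseq P)),
    feval phi t = feval phi u.

(** A quotient element is the predicate of all terms equivalent to a given one. As [Prop] is
    impredicative, quantifying over all operads in [feq] does not raise the universe, so the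
    quotient can itself be the underlying sequence of an operad. *)
Definition free_level (n : nat) : Type :=
  {A : set (fterm n) | exists t, A = feq t}.

Definition fpi n (t : fterm n) : free_level n :=
  exist _ (feq t) (ex_intro _ t erefl).

Definition frepr n (q : free_level n) : fterm n := sval (cid (svalP q)).

Definition fev (P : GSetOperad gT) (phi : SymSeq_hom S (op_symseq P)) n
  (q : free_level n) : P n := feval phi (frepr q).

Lemma frepr_pi n (t : fterm n) : feq t (frepr (fpi t)).
Proof.
rewrite /frepr; case: cid => u /= tu.
by have : feq u u by []; rewrite -tu.
Qed.

Lemma fpiK n (q : free_level n) : fpi (frepr q) = q.
Proof.
by case: q => A ?; apply: eq_exist; rewrite /frepr; case: cid => u /= ->.
Qed.

Lemma fev_pi P phi n (t : fterm n) : @fev P phi n (fpi t) = feval phi t.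
Proof. by rewrite /fev -(frepr_pi t). Qed.

Lemma free_ext n (q r : free_level n) :
  (forall P phi, @fev P phi n q = fev phi r) -> q = r.
Proof.
move=> qr; rewrite -(fpiK q) -(fpiK r); apply: eq_exist.
rewrite predeqE => u; split=> uE P phi; rewrite -uE; [symmetry|]; exact: qr.
Qed.

(** For the axioms whose two sides have arities equal only propositionally: the arity equation is
    supplied separately and eliminated before evaluating. *)
Lemma free_extT n m (q : free_level n) (r : free_level m) : n = m ->
  (forall (P : GSetOperad gT) phi,
     Tagged P (@fev P phi n q) = Tagged P (fev phi r)) ->
  Tagged free_level q = Tagged free_level r.
Proof.
move=> nm; subst m => qr; congr Tagged; apply: free_ext => P phi.
exact: Tagged_inj (qr P phi).
Qed.

Definition free_G n g (q : free_level n) := fpi (FG g (frepr q)).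
Definition free_S n (q : free_level n) s := fpi (FS (frepr q) s).
Definition free_id := fpi FId.
Definition free_comp k (j : 'I_k -> nat) (c : free_level k)
  (d : forall i, free_level (j i)) := fpi (FComp (frepr c) (fun i => frepr (d i))).

Section Laws.
Variables (P : GSetOperad gT) (phi : SymSeq_hom S (op_symseq P)).

Lemma fev_G n g (q : free_level n) :
  fev phi (free_G g q) = op_G (gso_str P) g (fev phi q).
Proof. exact: fev_pi. Qed.

Lemma fev_S n (q : free_level n) s :
  fev phi (free_S q s) = op_S (gso_str P) (fev phi q) s.
Proof. exact: fev_pi. Qed.

Lemma fev_id : fev phi free_id = op_id (gso_str P).
Proof. exact: fev_pi. Qed.

Lemma fev_comp k (j : 'I_k -> nat) (c : free_level k) (d : forall i, free_level (j i)) :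
  fev phi (free_comp c d) = op_comp (gso_str P) (fev phi c) (fun i => fev phi (d i)).
Proof. exact: fev_pi. Qed.

End Laws.

Let fevE := (fev_G, fev_S, fev_id, fev_comp).

Definition free_structure : operad_structure gT free_level.
Proof.
refine {| op_G := free_G; op_S := free_S; op_id := free_id; op_comp := free_comp |}.
- by move=> n f; apply: free_ext => P phi; rewrite !fevE op_G1.
- by move=> n g h f; apply: free_ext => P phi; rewrite !fevE op_GM.
- by move=> n f; apply: free_ext => P phi; rewrite !fevE op_S1.
- by move=> n f s t; apply: free_ext => P phi; rewrite !fevE op_SM.
- by move=> n g f s; apply: free_ext => P phi; rewrite !fevE op_GS.
- by move=> g; apply: free_ext => P phi; rewrite !fevE op_G_id.
- move=> g k j c d; apply: free_ext => P phi; rewrite !fevE op_G_comp.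
  by apply: eq_op_comp_fun => i; rewrite fevE.
- move=> n f; apply: free_extT => [|P phi]; first exact: sum_ord1.
  by rewrite !fevE op_comp1l.
- move=> n f; apply: free_extT => [|P phi]; first exact: sum_ord_const1.
  by rewrite !fevE op_comp1r.
- move=> k j m c d e; apply: free_extT => [|P phi]; first exact: sum_sum_blocks.
  rewrite !fevE.
  have -> := op_compA (gso_str P) (fev phi c) (fun i => fev phi (d i))
    (fun i l => fev phi (e i l)).
  by congr Tagged; apply: eq_op_comp_fun => i; rewrite fevE.
- move=> k j c d s; apply: free_extT => [|P phi]; first by rewrite (block_perm_size j s).
  by rewrite !fevE -op_comp_block_perm.
- move=> k j c d t; apply: free_ext => P phi; rewrite !fevE.
  by rewrite -op_comp_block_sum; apply: eq_op_comp_fun => i; rewrite fevE.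
Defined.

Definition free_operad : GSetOperad gT := Build_GSetOperad free_structure.

Lemma fpi_gen_map : @is_symseq_map gT S (op_symseq free_operad)
  (fun n x => fpi (FGen x)).
Proof.
move=> n p x; apply: free_ext => P phi.
by rewrite /= /op_act /= !fevE !fev_pi /= (svalP phi).
Qed.

Definition free_unit : SymSeq_hom S (op_symseq free_operad) :=
  exist _ _ fpi_gen_map.

Lemma fev_is_operad_map P phi : is_operad_map free_structure (gso_str P) (@fev P phi).
Proof. by split=> *; rewrite /= fevE. Qed.

Definition free_lift P (phi : SymSeq_hom S (op_symseq P)) :
  GSetOperad_hom free_operad P := exist _ _ (fev_is_operad_map phi).

Lemma free_lift_unit P (phi : SymSeq_hom S (op_symseq P)) n (x : S n) :
  sval (free_lift phi) n (sval free_unit n x) = sval phi n x.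
Proof. exact: fev_pi. Qed.

(** Every element is the class of a term, and operad maps commute with each term constructor, so
    induction on terms reduces to generators. *)
Lemma free_hom_ext P (f g : GSetOperad_hom free_operad P) :
  (forall n x, sval f n (sval free_unit n x) = sval g n (sval free_unit n x)) -> f = g.
Proof.
move=> fg; apply: sval_ext.
have main n (t : fterm n) : sval f n (fpi t) = sval g n (fpi t).
  elim: t => {n} [n x|n h t IH|n t IH s||k j c IHc d IHd].
  - exact: fg.
  - have -> : fpi (FG h t) = op_G free_structure h (fpi t).
      by apply: free_ext => Q phi; rewrite !fevE !fev_pi.
    by rewrite (om_G (svalP f)) (om_G (svalP g)) IH.
  - have -> : fpi (FS t s) = op_S free_structure (fpi t) s.
      by apply: free_ext => Q phi; rewrite !fevE !fev_pi.
    by rewrite (om_S (svalP f)) (om_S (svalP g)) IH.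
  - by rewrite (om_id (svalP f)) (om_id (svalP g)).
  - have -> : fpi (FComp c d) = op_comp free_structure (fpi c) (fun i => fpi (d i)).
      apply: free_ext => Q phi; rewrite !fevE !fev_pi /=.
      by apply: eq_op_comp_fun => i; rewrite fev_pi.
    rewrite (om_comp (svalP f)) (om_comp (svalP g)) IHc.
    by apply: eq_op_comp_fun => i; rewrite IHd.
by apply: functional_extensionality_dep => n; apply/funext => q; rewrite -(fpiK q).
Qed.

End FreeOperad.

Lemma symseq_hom_ext gT (S T : SymSeq gT) (f g : SymSeq_hom S T) :
  (forall n x, sval f n x = sval g n x) -> f = g.
Proof.
move=> fg; apply: sval_ext; apply: functional_extensionality_dep => n.
exact/funext.
Qed.

Definition free_functor gT : Functor (SymSeqCat gT) (GSetOperadCat gT).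
Proof.
exists (fun S => free_operad S)
  (fun S T f => free_lift (@cmp (SymSeqCat gT) S T (op_symseq (free_operad T))
                    (free_unit T) f)).
- by move=> S; apply: free_hom_ext => n x; rewrite free_lift_unit.
- by move=> S T U g f; apply: free_hom_ext => n x; rewrite /= !fev_pi.
Defined.

Definition free_adjoint gT : LeftAdjoint (forgetful gT).
Proof.
exists (free_functor gT) (fun S => free_unit S).
- by move=> S T f; apply: symseq_hom_ext => n x; exact: free_lift_unit.
- move=> S P f; exists (free_lift f); split.
    by apply: symseq_hom_ext => n x; exact: free_lift_unit.
  move=> g gE; apply: free_hom_ext => n x; rewrite free_lift_unit.
  by rewrite -gE.
Defined.

(** * Indexing systems *)

Lemma inj_surj_bij (A : Type) (B : Type) (f : A -> B) :
  injective f -> (forall y, exists x, f x = y) -> bijective f.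
Proof.
move=> finj fsur; have [g gK] := boolp.choice fsur.
by exists g => // x; apply: finj; rewrite gK.
Qed.

(** * Orbits and stabilizers of finite [H]-sets *)

Section HSetLemmas.
Variable gT : finGroupType.
Implicit Types H K : {group gT}.

Lemma hs_iso_sym H (S T : HSet H) : hs_iso S T -> hs_iso T S.
Proof.
case=> f [g fK gK] fE; exists g; first by exists f.
by move=> a x; apply: (can_inj fK); rewrite fE !gK.
Qed.

Definition in_hs_sub H (T : HSet H) (U : {set T}) (stU : hs_stable U) x
  (xU : x \in U) : hs_sub stU := exist _ x xU.

Section Orbits.
Variables (H : {group gT}) (T : HSet H) (x : T).

Definition hs_stab_set : {set gT} := [set sgval a | a in [set a | hs_act a x == x]].

Lemma hs_stabP (a : subg_of H) :
  reflect (hs_act a x = x) (sgval a \in hs_stab_set).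
Proof.
apply: (iffP imsetP) => [[b + /val_inj ->]|ax]; first by rewrite inE => /eqP.
by exists a; rewrite // inE ax.
Qed.

Fact hs_stab_group_set : group_set hs_stab_set.
Proof.
apply/group_setP; split; first by apply/(hs_stabP 1); rewrite hs_act1.
move=> _ _ /imsetP[a + ->] /imsetP[b + ->]; rewrite !inE => /eqP ax /eqP bx.
by apply/(hs_stabP (a * b)); rewrite hs_actM bx.
Qed.

Canonical hs_stab : {group gT} := Group hs_stab_group_set.

Lemma hs_stab_sub : hs_stab \subset H.
Proof. by apply/fintype.subsetP => _ /imsetP[a _ ->]; exact: subgP. Qed.

Definition hs_orb : {set T} := [set hs_act a x | a : subg_of H].

Lemma hs_orb_stable : hs_stable hs_orb.
Proof.
by move=> a _ /imsetP[b _ ->]; apply/imsetP; exists (a * b); rewrite ?hs_actM.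
Qed.

Lemma hs_orb_id : x \in hs_orb.
Proof. by apply/imsetP; exists 1; rewrite ?hs_act1. Qed.

(** Orbit-stabilizer: a chosen representative of each coset is applied to [x]; by [actE] the result
    depends only on the coset and determines it. *)
Lemma hs_orb_iso : hs_iso (hs_orbit H hs_stab) (hs_sub hs_orb_stable).
Proof.
have actE (a b : subg_of H) :
    sgval b \in sgval a *: hs_stab <-> hs_act b x = hs_act a x.
  rewrite mem_lcoset -[_ * _]/(sgval (a^-1 * b)).
  split=> [/hs_stabP|ab].
    by rewrite hs_actM => /(congr1 (hs_act a)); rewrite hs_actVK.
  by apply/hs_stabP; rewrite hs_actM ab hs_actK.
have reprE (C : hs_orbit H hs_stab) :
    exists a : subg_of H, val C = sgval a *: hs_stab.
  case: C => C /= /lcosetsP[h hH ->].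
  by exists (subg H h); rewrite subgK.
have [r rE] := boolp.choice reprE.
have rU C : hs_act (r C) x \in hs_orb by apply/imsetP; exists (r C).
exists (fun C => exist _ (hs_act (r C) x) (rU C)).
  apply: inj_surj_bij => [C D /(congr1 val) /= CD|[z zU]].
    apply: val_inj; rewrite !rE; apply/lcoset_eqP; exact/actE.
  have /imsetP[a _ zE] := zU.
  have CP : sgval a *: hs_stab \in lcosets hs_stab H.
    by apply/lcosetsP; exists (sgval a); rewrite ?subgP.
  pose C0 : hs_orbit H hs_stab :=
    exist (fun C : {set gT} => C \in lcosets hs_stab H) _ CP.
  exists C0; apply: val_inj; rewrite /= zE; apply/actE.
  by have /= -> := rE C0; exact: lcoset_refl.
move=> a C; apply: val_inj => /=; rewrite -hs_actM; apply/actE.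
have -> : (sgval a * sgval (r C)) *: hs_stab = sgval (r (hs_act a C)) *: hs_stab.
  by rewrite lcosetM; transitivity (val (hs_act a C)); rewrite -?rE.
exact: lcoset_refl.
Qed.

End Orbits.

Lemma hs_iso_subT H (T : HSet H) (U : {set T}) (stU : hs_stable U) :
  (forall x, x \in U) -> hs_iso (hs_sub stU) T.
Proof.
move=> UT; exists (fun z => sval z) => //.
by exists (fun x => exist _ x (UT x)) => // -[x xU]; apply: val_inj.
Qed.

End HSetLemmas.

(** * Unions, coverings and fibrations in an indexing system *)

Section IndexingSystems.
Variable gT : finGroupType.
Implicit Types (H K : {group gT}) (I : IndexingSystem gT).

(** The two sets may overlap, so the union is presented as the coproduct of [A] and the stable set
    of points of [B] outside [A]. *)
Lemma isys_union I H (T : HSet H) (A B : {set T}) (stA : hs_stable A)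
    (stB : hs_stable B) : I H (hs_sub stA) -> I H (hs_sub stB) ->
  exists stU : hs_stable (A :|: B), I H (hs_sub stU).
Proof.
move=> IA IB.
have stU : hs_stable (A :|: B).
  move=> a x; rewrite !inE => /orP[/(stA a) ->//|/(stB a) ->]; exact: orbT.
exists stU.
pose C : {set hs_sub stB} := [set z | sval z \notin A].
have stC : hs_stable C.
  move=> a [x xB]; rewrite !inE /=; apply: contra => /(stA a^-1).
  by rewrite hs_actK.
apply: (isys_iso _ (isys_sum IA (isys_sub stC IB))).
have inU (z : hs_sum (hs_sub stA) (hs_sub stC)) :
    (match z with inl x => sval x | inr y => sval (sval y) end) \in A :|: B.
  by case: z => [[x xA]|[[y yB] yC]]; rewrite inE /= ?xA ?yB ?orbT.
exists (fun z => in_hs_sub stU (inU z)).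
  apply: inj_surj_bij => [z z' /(congr1 val) /=|[x xU]].
    case: z z' => [[x xA]|[[y yB] +]] [[x' xA']|[[y' yB'] +]] /=.
    - by move=> xx'; congr inl; apply: val_inj.
    - by move=> yC xy; exfalso; have := yC; rewrite inE /= -xy xA.
    - by move=> yC yx; exfalso; have := yC; rewrite inE /= yx xA'.
    - by move=> yC yC' yy'; congr inr; do 2 apply: val_inj.
  have [xA|xA] := boolP (x \in A); first by exists (inl (in_hs_sub stA xA)); apply: val_inj.
  have xB : x \in B by move: xU; rewrite inE (negPf xA).
  have xC : in_hs_sub stB xB \in C by rewrite inE.
  by exists (inr (in_hs_sub stC xC)); apply: val_inj.
by move=> a [[x xA]|[[y yB] yC]]; apply: val_inj.
Qed.

(** The points of [T] are listed and their stable sets joined one at a time by [isys_union]. *)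
Lemma isys_cover I H (T : HSet H) :
  (forall x : T, exists U (stU : hs_stable U), x \in U /\ I H (hs_sub stU)) ->
  I H T.
Proof.
move=> cov.
have [U [stU [UT IU]]] : exists (U : {set T}) (stU : hs_stable U),
    {subset enum T <= U} /\ I H (hs_sub stU).
  elim: (enum T) => [|x s [U [stU [sU IU]]]].
    have st0 : hs_stable (finset.set0 : {set T}) by move=> a x; rewrite inE.
    exists finset.set0, st0; split=> //; apply: isys_trivial => a [x x0].
    by exfalso; rewrite inE in x0.
  have [V [stV [xV IV]]] := cov x; have [stW IW] := isys_union IV IU.
  exists (V :|: U), stW; split=> // y; rewrite !inE => /predU1P[->|/sU ->].
    by rewrite xV.
  exact: orbT.
by apply: isys_iso IU; apply: hs_iso_subT => x; apply: UT; rewrite mem_enum.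
Qed.

Lemma isys_le_orbits I (J : IndexingSystem gT) :
  (forall H K, K \subset H -> K <> H -> I H (hs_orbit H K) -> J H (hs_orbit H K)) ->
  isys_le I J.
Proof.
move=> IJ H T IT; apply: isys_cover => x.
exists (hs_orb x), (@hs_orb_stable _ _ _ x); split; first exact: hs_orb_id.
have iso := hs_orb_iso x; apply: (isys_iso iso).
(* An orbit with full stabilizer is a single fixed point, which lies in every indexing system. *)
have [stabE|stabN] := pselect (hs_stab x = H); last first.
  apply: IJ => //; first exact: hs_stab_sub.
  by apply: isys_iso (hs_iso_sym iso) _; exact: isys_sub.
apply: isys_trivial => a [C CH]; apply: val_inj => /=.
case/lcosetsP: (CH) => h hH ->; rewrite stabE -lcosetM.
by rewrite !lcoset_id ?groupM ?subgP.
Qed.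

Lemma isys_fibration I H (T B : HSet H) (p : T -> B) :
  (forall a x, p (hs_act a x) = hs_act a (p x)) -> I H B ->
  (forall b K (sKH : K \subset H)
     (stF : hs_stable (T := hs_res sKH T) [set x | p x == b]),
     (forall a : subg_of K, hs_act (subg_incl H a) b = b) -> I K (hs_sub stF)) ->
  I H T.
Proof.
move=> pE IB IF; apply: isys_cover => x; pose b := p x; pose K := hs_stab b.
have sKH : K \subset H := hs_stab_sub b.
have fixb (a : subg_of K) : hs_act (subg_incl H a) b = b.
  by apply/hs_stabP; rewrite subg_inclE // subgP.
have stF : hs_stable (T := hs_res sKH T) [set x | p x == b].
  by move=> a z; rewrite !inE /= pE => /eqP ->; rewrite fixb.
pose F := hs_sub stF; have IFF : I K F by exact: IF.
have IHK : I H (hs_orbit H K).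
  apply: isys_iso (hs_iso_sym (hs_orb_iso b)) _; exact: isys_sub.
pose U : {set T} := [set z | p z \in hs_orb b].
have stU : hs_stable U by move=> a z; rewrite !inE pE; exact: hs_orb_stable.
exists U, stU; split; first by rewrite inE hs_orb_id.
apply: isys_iso (isys_ind sKH IFF IHK).
have inclV (a : subg_of K) : subg_incl H a^-1 = (subg_incl H a)^-1.
  by apply: (mulIg (subg_incl H a)); rewrite mulVg -subg_inclM // mulVg subg_incl1.
(* If [h y = h' y'], applying [p] shows that [h'^-1 h] fixes [b]; hence it lies in [K], and the two
   pairs differ by its action. *)
have classE (q r : subg_of H * F) : (ind_class q = ind_class r :> {set _}) <->
    hs_act q.1 (sval q.2) = hs_act r.1 (sval r.2).
  split=> [qr|].
    have : q \in ind_class r.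
      rewrite -qr; apply/imsetP; exists 1 => //.
      by rewrite hs_act1 (subg_incl1 sKH) invg1 mulg1 -surjective_pairing.
    by case/imsetP=> a _ -> /=; rewrite hs_actM hs_actK.
  case: q r => [h y] [h' y'] /= e.
  have hb : hs_act (h'^-1 * h) b = b.
    have pb (z : F) : p (sval z) = b by have := svalP z; rewrite inE => /eqP.
    by rewrite hs_actM -{1}(pb y) -pE e pE pb hs_actK.
  have kK : sgval (h'^-1 * h) \in K by apply/hs_stabP.
  pose k := subg K (sgval (h'^-1 * h)).
  have kE : subg_incl H k = h'^-1 * h.
    by apply: val_inj; rewrite /= subg_inclE // subgK.
  have -> : h = h' * subg_incl H k by rewrite kE mulKVg.
  have -> : y' = hs_act k y.
    by apply: val_inj; rewrite /= kE hs_actM e hs_actK.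
  apply/finset.setP => q; apply/imsetP/imsetP => [[a _ ->]|[a _ ->]].
    exists (a * k^-1) => //; rewrite -hs_actM mulgKV; congr (_, _).
    by rewrite subg_inclM // inclV invMg invgK mulgA.
  exists (a * k) => //; rewrite hs_actM; congr (_, _).
  by rewrite subg_inclM // invMg mulgA mulgK.
have reprE (C : hs_ind H F) : exists q : subg_of H * F, val C = ind_class q.
  by case: C => C /= /imsetP[q _ ->]; exists q.
have [r rE] := boolp.choice reprE.
have rU C : hs_act (r C).1 (sval (r C).2) \in U.
  rewrite inE pE; apply/imsetP; exists (r C).1 => //; congr hs_act.
  by have := svalP (r C).2; rewrite inE => /eqP.
exists (fun C => in_hs_sub stU (rU C)).
  apply: inj_surj_bij => [C D /(congr1 val) /= CD|[z zU]].
    by apply: val_inj; rewrite !rE; apply/classE.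
  have /imsetP[a _ pz] : p z \in hs_orb b by move: zU; rewrite inE.
  have yF : hs_act a^-1 z \in [set x | p x == b] by rewrite inE pE pz hs_actK.
  pose y : F := in_hs_sub stF yF.
  have CP : ind_class (a, y) \in ind_classes H F by exact: imset_f.
  pose C0 : hs_ind H F := exist (fun C => C \in ind_classes H F) _ CP.
  exists C0; apply: val_inj => /=.
  have /classE -> : ind_class (r C0) = ind_class (a, y) by rewrite -rE.
  by rewrite /= hs_actVK.
move=> a C; apply: val_inj => /=; rewrite -hs_actM.
by have /classE -> : ind_class (r (hs_act a C)) = ind_class (a * (r C).1, (r C).2);
  rewrite // -rE /= rE ind_act_class.
Qed.

End IndexingSystems.

(** * An operad of trees realizing an indexing system *)

Section SupportedTerms.
Variable gT : finGroupType.

(* In Node A c only the subtrees c D with D in A may have leaves; indexing the *)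
(* children by all subsets keeps the translation action free of dependent types. *)
Inductive term (X : Type) : Type :=
  | Leaf of X
  | Stub
  | Node of {set {set gT}} & ({set gT} -> term X).

Arguments Stub {X}.

Fixpoint bind X Y (t : term X) (f : X -> term Y) : term Y :=
  match t with
  | Leaf x => f x
  | Stub => Stub
  | Node A c => Node A (fun D => bind (c D) f)
  end.

Definition tmap X Y (f : X -> Y) (t : term X) : term Y :=
  bind t (fun x => Leaf (f x)).

Definition translate (g : gT) (A : {set {set gT}}) : {set {set gT}} :=
  [set g *: D | D : {set gT} in A].

Fixpoint gact X (g : gT) (t : term X) : term X :=
  match t with
  | Leaf x => Leaf x
  | Stub => Stub
  | Node A c => Node (translate g A) (fun D => gact g (c (g^-1 *: D)))
  end.

Fixpoint cnt X (p : pred X) (t : term X) : nat :=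
  match t with
  | Leaf x => p x
  | Stub => 0
  | Node A c => \sum_(D : {set gT}) cnt p (c D)
  end.

Lemma eq_bind X Y (t : term X) (f g : X -> term Y) :
  f =1 g -> bind t f = bind t g.
Proof. by move=> fg; congr bind; exact/funext. Qed.

Lemma eq_tmap X Y (f g : X -> Y) t : f =1 g -> tmap f t = tmap g t.
Proof. by move=> fg; apply: eq_bind => x; rewrite fg. Qed.

Lemma bind_bind X Y Z (t : term X) (f : X -> term Y) (g : Y -> term Z) :
  bind (bind t f) g = bind t (fun x => bind (f x) g).
Proof.
by elim: t => //= A c IH; congr Node; apply/funext => D.
Qed.

Lemma tmap_id X (t : term X) : tmap id t = t.
Proof.
by elim: t => //= A c IH; congr Node; apply/funext => D; exact: IH.
Qed.

Lemma tmap_id_ext X (f : X -> X) t : f =1 id -> tmap f t = t.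
Proof. by move=> /eq_tmap ->; exact: tmap_id. Qed.

Lemma tmap_comp X Y Z (f : X -> Y) (g : Y -> Z) t :
  tmap g (tmap f t) = tmap (g \o f) t.
Proof. exact: bind_bind. Qed.

Lemma translate1 A : translate 1 A = A.
Proof.
rewrite -[RHS]imset_id; apply: eq_imset => D; exact: lcoset1.
Qed.

Lemma translateM g h A : translate (g * h) A = translate g (translate h A).
Proof.
rewrite /translate -imset_comp; apply: eq_imset => D; exact: lcosetM.
Qed.

Lemma mem_translate g A D : (D \in translate g A) = (g^-1 *: D \in A).
Proof.
apply/imsetP/idP => [[E EA ->]|DA]; first by rewrite -lcosetM mulVg lcoset1.
by exists (g^-1 *: D); rewrite // -lcosetM mulgV lcoset1.
Qed.

Lemma gact1 X (t : term X) : gact 1 t = t.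
Proof.
elim: t => //= A c IH; rewrite translate1; congr Node.
by apply/funext => D; rewrite IH invg1 lcoset1.
Qed.

Lemma gactM X g h (t : term X) : gact (g * h) t = gact g (gact h t).
Proof.
elim: t => //= A c IH; rewrite translateM; congr Node.
by apply/funext => D; rewrite IH invMg lcosetM.
Qed.

Lemma gact_bind X Y g (t : term X) (f : X -> term Y) :
  gact g (bind t f) = bind (gact g t) (fun x => gact g (f x)).
Proof.
by elim: t => //= A c IH; congr Node; apply/funext => D; exact: IH.
Qed.

Lemma gact_tmap X Y g (t : term X) (f : X -> Y) :
  gact g (tmap f t) = tmap f (gact g t).
Proof. exact: gact_bind. Qed.

Lemma cnt_tmap X Y (f : X -> Y) (p : pred Y) t : cnt p (tmap f t) = cnt (p \o f) t.
Proof. by elim: t => //= A c IH; apply: eq_bigr => D _; exact: IH. Qed.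

Lemma cnt_gact X (p : pred X) g t : cnt p (gact g t) = cnt p t.
Proof.
elim: t => //= A c IH; rewrite [RHS](reindex_inj (@lcoset_inj _ g^-1)) /=.
by apply: eq_bigr => D _; exact: IH.
Qed.

Lemma cnt_bind (X : finType) Y (t : term X) (f : X -> term Y) p :
  cnt p (bind t f) = (\sum_x cnt (pred1 x) t * cnt p (f x))%N.
Proof.
elim: t => [x||A c IH] /=.
- rewrite (bigD1 x) //= eqxx mul1n big1 ?addn0 // => y /negPf.
  by rewrite eq_sym => ->.
- by rewrite big1.
under eq_bigr => D _ do rewrite IH.
by rewrite exchange_big; apply: eq_bigr => x _; rewrite big_distrl.
Qed.

Lemma leq_cnt X (p q : pred X) t : subpred p q -> (cnt p t <= cnt q t)%N.
Proof.
move=> pq; elim: t => [x||A c IH] //=; last exact: leq_sum.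
by case: (boolP (p x)) => // /pq ->.
Qed.

Lemma cnt_bind0 X Y (t : term X) (f : X -> term Y) p :
  cnt predT t = 0%N -> cnt p (bind t f) = 0%N.
Proof.
elim: t => //= A c IH /eqP; rewrite sum_nat_eq0 => /forallP c0.
by rewrite big1 // => D _; apply: IH; apply/eqP; exact: c0.
Qed.

(* All leaves occur, so a relabelling fixing the term is trivial. *)
Lemma tmap_fixed (X : eqType) (f : X -> X) t x :
  tmap f t = t -> (0 < cnt (pred1 x) t)%N -> f x = x.
Proof.
elim: t => [y|//|A c IH] /=.
  by move=> [fy]; rewrite lt0b => /eqP <-.
move=> [fc]; rewrite lt0n sum_nat_eq0 => /forallPn[D /=].
by rewrite -lt0n; apply: IH; exact: (congr1 (@^~ D) fc).
Qed.

Variable good : {set {set gT}} -> Prop.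

Fixpoint wf X (t : term X) : Prop :=
  match t with
  | Leaf _ | Stub => True
  | Node A c => [/\ good A, forall D, D \notin A -> cnt predT (c D) = 0%N
                  & forall D, wf (c D)]
  end.

Lemma wf_bind X Y (t : term X) (f : X -> term Y) :
  wf t -> (forall x, wf (f x)) -> wf (bind t f).
Proof.
move=> + wff; elim: t => //= A c IH [gA c0 wc]; split=> // D; last exact: IH.
by move/c0; exact: cnt_bind0.
Qed.

Lemma wf_tmap X Y (f : X -> Y) t : wf t -> wf (tmap f t).
Proof. by move=> wt; exact: wf_bind. Qed.

Hypothesis good_translate : forall g A, good A -> good (translate g A).

Lemma wf_gact X g (t : term X) : wf t -> wf (gact g t).
Proof.
elim: t => //= A c IH [gA c0 wc]; split=> [|D|D]; first exact: good_translate.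
  by rewrite mem_translate cnt_gact => /c0.
exact: IH.
Qed.

Definition linear (X : eqType) (t : term X) : Prop :=
  forall x, cnt (pred1 x) t = 1%N.

Lemma cnt_linear (X : finType) (t : term X) p :
  linear t -> cnt p t = (\sum_x p x)%N.
Proof.
(* Seen as its own substitution by leaves, [t] has its count split by label. *)
move=> lt; rewrite -[t in cnt p t]tmap_id cnt_bind.
by apply: eq_bigr => x _; rewrite lt mul1n.
Qed.

Definition tree_level (n : nat) : Type := {t : term 'I_n | wf t /\ linear t}.

Lemma tree_GP n g (f : tree_level n) : wf (gact g (sval f)) /\ linear (gact g (sval f)).
Proof.
by case: f => t [wt lt]; split=> [|x]; [exact: wf_gact|rewrite cnt_gact].
Qed.

(** Relabelling by the inverse gives a right action; the leaf labelled [x] afterwards was labelled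
    [s x] before. *)
Lemma tree_SP n (f : tree_level n) (s : Sigma n) :
  wf (tmap (s^-1 : Sigma n)%g (sval f)) /\ linear (tmap (s^-1 : Sigma n)%g (sval f)).
Proof.
case: f => t [wt lt]; split=> [|x]; first exact: wf_tmap.
rewrite cnt_tmap (cnt_linear _ lt) (bigD1 (s x)) //= sigmaK eqxx big1 // => y.
by apply: contra_neq_eq; rewrite eqb0 negbK => /eqP <-; rewrite sigmaKV.
Qed.

Lemma tree_idP : wf (Leaf (ord0 : 'I_1)) /\ linear (Leaf (ord0 : 'I_1)).
Proof. by split=> // x; rewrite (ord1 x). Qed.

Lemma tree_compP k (j : 'I_k -> nat) (c : tree_level k) (d : forall i, tree_level (j i)) :
  let t := bind (sval c) (fun i => tmap (tagnat.Rank i) (sval (d i))) in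
  wf t /\ linear t.
Proof.
case: c => c [wc lc]; split=> [|x].
  by apply: wf_bind => // i; apply: wf_tmap; case: (svalP (d i)).
rewrite cnt_bind.
under eq_bigr => i _.
  rewrite lc mul1n cnt_tmap cnt_linear; last by case: (svalP (d i)).
  over.
pose hit i (l : 'I_(j i)) : nat := tagnat.Rank i l == x.
rewrite /= -(sum_blocks hit (fun=> xpredT)) /hit.
rewrite (bigD1 x) //= tagnat.sig2K eqxx big1 // => y /negPf.
by rewrite tagnat.sig2K => ->.
Qed.

Definition tree_G n g (f : tree_level n) : tree_level n := exist _ _ (tree_GP g f).
Definition tree_S n (f : tree_level n) s : tree_level n := exist _ _ (tree_SP f s).
Definition tree_id : tree_level 1 := exist _ _ tree_idP.
Definition tree_comp k (j : 'I_k -> nat) (c : tree_level k)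
  (d : forall i, tree_level (j i)) : tree_level (\sum_i j i)%N :=
  exist _ _ (tree_compP c d).

(** A value-preserving relabelling plays the role of the cast between the two ordinals, so that no
    casts enter the terms. *)
Lemma tree_Tagged n m (x : tree_level n) (y : tree_level m) : n = m ->
  (forall f : 'I_n -> 'I_m, (forall i, f i = i :> nat) ->
     tmap f (sval x) = sval y) ->
  Tagged tree_level x = Tagged tree_level y.
Proof.
move=> nm; subst m => /(_ id (fun=> erefl)); rewrite tmap_id => xy.
by congr Tagged; exact: sval_ext.
Qed.

Lemma tmap_Tagged Y n m (u : tree_level n) (v : tree_level m)
    (f : 'I_n -> Y) (g : 'I_m -> Y) :
  Tagged tree_level u = Tagged tree_level v ->
  (forall (x : 'I_n) (x' : 'I_m), x = x' :> nat -> f x = g x') ->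
  tmap f (sval u) = tmap g (sval v).
Proof.
move=> uv; have nm : n = m := congr1 tag uv.
subst m => fg; rewrite (Tagged_inj uv); apply: eq_tmap => x; exact: fg.
Qed.

Definition tree_structure : operad_structure gT tree_level.
Proof.
refine {| op_G := tree_G; op_S := tree_S; op_id := tree_id; op_comp := tree_comp |}.
- by move=> n f; apply: sval_ext; exact: gact1.
- by move=> n g h f; apply: sval_ext; exact: gactM.
- move=> n f; apply: sval_ext; apply: tmap_id_ext => i.
  by rewrite invg1 sigma1.
- move=> n f s t; apply: sval_ext; rewrite /= tmap_comp; apply: eq_tmap => i.
  by rewrite invMg sigmaM.
- by move=> n g f s; apply: sval_ext; exact: gact_tmap.
- by move=> g; apply: sval_ext.
- move=> g k j c d; apply: sval_ext; rewrite /= gact_bind; apply: eq_bind => i.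
  exact: gact_tmap.
- move=> n f; apply: tree_Tagged => [|phi phiE]; first exact: sum_ord1.
  rewrite /= tmap_comp; apply: tmap_id_ext => i; apply: val_inj.
  by rewrite /= phiE Rank_ord1.
- move=> n f; apply: tree_Tagged => [|phi phiE]; first exact: sum_ord_const1.
  rewrite [LHS]bind_bind; apply: tmap_id_ext => i; apply: val_inj.
  by rewrite /= phiE Rank_const1.
- move=> k j m c d e; apply: tree_Tagged => [|phi phiE]; first exact: sum_sum_blocks.
  rewrite /= /tmap !bind_bind; apply: eq_bind => i.
  rewrite !bind_bind; apply: eq_bind => l /=.
  rewrite !bind_bind /=.
  (* Both sides are now relabellings of a third-level tree. On the left it is [e] at the indices
     recovered from a rank; [Rank_assoc] matches the labels. *)
  pose E i l := Tagged tree_level (e i l).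
  apply: (@tmap_Tagged _ _ _ (e _ _) (e i l)) => [|x x' xx'].
    by rewrite -/(E _ _) /tagnat.sig1 /tagnat.sig2 tagnat.rankK.
  by apply: val_inj; rewrite /= phiE; exact: Rank_assoc.
- move=> k j c d s; apply: tree_Tagged => [|phi phiE].
    by rewrite (block_perm_size j s).
  rewrite /= /tmap !bind_bind; apply: eq_bind => i /=.
  (* Replacing [s^-1 i] by a variable [i'] with [s i' = i] lets the equation be eliminated, so that
     both sides speak of [d (s i')]. *)
  move: ((s^-1 : Sigma k)%g i) (sigmaKV s i) => i' ii'; case: _ / ii'.
  rewrite !bind_bind; apply: eq_bind => l /=; congr Leaf.
  apply: (@sigma_inj _ (block_perm j s)); rewrite sigmaKV mk_sigmaE.
  rewrite /block_perm_fun; set b := cast_ord _ _.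
  have -> : b = tagnat.Rank (p_ := fun i => j (s i)) i' l.
    by apply: val_inj; rewrite /= phiE.
  by rewrite /tagnat.sig1 /tagnat.sig2 tagnat.rankK.
- move=> k j c d t; apply: sval_ext; rewrite /= /tmap !bind_bind.
  apply: eq_bind => i; rewrite !bind_bind; apply: eq_bind => l /=; congr Leaf.
  apply: (@sigma_inj _ (block_sum t)); rewrite sigmaKV mk_sigmaE /block_sum_fun.
  by rewrite /tagnat.sig1 /tagnat.sig2 tagnat.rankK /= sigmaKV.
Defined.

Lemma tree_Sigma_free : Sigma_free tree_structure.
Proof.
move=> n [t [wt lt]] s /(congr1 sval) /= tE; apply: sigmaP => i.
(* The relabelling is by [s^-1]; that it fixes the label [s i] says [i = s i]. *)
have := tmap_fixed (x := s i) tE; rewrite lt sigmaK sigma1 => /(_ isT) <- //.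
Qed.

End SupportedTerms.

(** * Trees with supports in an indexing system *)

Section TreeOperadOfIndexingSystem.
Variables (gT : finGroupType) (I : IndexingSystem gT).
Implicit Types H K : {group gT}.

Definition hs_pow H : HSet H.
Proof.
exists {set gT} (fun a D => sgval a *: D) => [D|a b D].
- exact: lcoset1.
- exact: lcosetM.
Defined.

(* Quantifying over translates makes this invariant under translation without *)
(* identifying (H :^ g) :^ g^-1 with H.                                        *)
Definition supported (A : {set {set gT}}) : Prop :=
  forall g H (st : hs_stable (translate g A : {set hs_pow H})), I H (hs_sub st).

Lemma supported_translate g A : supported A -> supported (translate g A).
Proof. by move=> sA h; rewrite -translateM; exact: sA. Qed.

Lemma supported_sub (A : {set {set gT}}) H (st : hs_stable (A : {set hs_pow H})) :
  supported A -> I H (hs_sub st).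
Proof. by move=> /(_ 1 H); rewrite translate1 => /(_ st). Qed.

Lemma supported_fixed (A : {set {set gT}}) :
  (forall (g : gT) D, D \in A -> g *: D = D) -> supported A.
Proof.
move=> fA g H st; apply: isys_trivial => a [D DA]; apply: val_inj => /=.
by case/imsetP: DA => E EA ->; rewrite -lcosetM !fA.
Qed.

(** If [L] stabilizes the [g]-translate of the cosets, then [L] lies in [g H g^-1], and the
    translate is the restriction to [L] of the conjugate of [H/K] by [g]. *)
Lemma supported_lcosets H K :
  K \subset H -> I H (hs_orbit H K) -> supported (lcosets K H).
Proof.
move=> sKH IHK g L st.
(* An element [a] of [L] sends [g K] to some [g h K], so [g^-1 a g] lies in [h K], inside [H]. *)
have sLH : L \subset (H :^ g^-1)%G.
  apply/fintype.subsetP => a aL; rewrite mem_conjg invgK.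
  have KK : (K : {set gT}) \in lcosets K H.
    by apply/lcosetsP; exists 1; rewrite ?lcoset1.
  have := st (subg L a) _ (imset_f (fun D : {set gT} => g *: D) KK).
  rewrite /= subgK // => /imsetP[_ /lcosetsP[h hH ->]].
  rewrite -!lcosetM => e; have : a * g \in (g * h) *: K by rewrite -e lcoset_refl.
  rewrite mem_lcoset => /(fintype.subsetP sKH) kH.
  have -> : a ^ g = h * ((g * h)^-1 * (a * g)).
    by rewrite conjgE invMg !mulgA mulgV mul1g.
  exact: groupM.
apply: isys_iso (isys_res sLH (isys_conj g IHK)).
have gD (C : hs_res sLH (hs_conj g (hs_orbit H K))) :
    g *: val C \in translate g (lcosets K H).
  exact/imset_f/(svalP C).
exists (fun C => in_hs_sub st (gD C)).
  apply: inj_surj_bij => [C D /(congr1 sval) /= /lcoset_inj|[D DA]].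
    exact: val_inj.
  case/imsetP: (DA) => C CK DE.
  by exists (exist _ C CK); apply: val_inj; rewrite /= DE.
move=> a C; apply: val_inj => /=.
by rewrite subg_conjE subg_inclE // -!lcosetM -conjgC.
Qed.

(* The support B of the root of t is an H-set in I, and the leaves of t map to *)
(* B with fibers the leaves of the subtrees at the children of the root.       *)
Lemma isys_of_fixed_tree (X : eqType) (t : term gT X) : wf supported t ->
  forall H (T : HSet H) (e : T -> X), injective e ->
  (forall z, cnt (pred1 (e z)) t = 1%N) ->
  (forall a : subg_of H, exists phi : X -> X, tmap phi (gact (sgval a) t) = t /\
     forall z, phi (e z) = e (hs_act a z)) ->
  I H T.
Proof.
elim: t => [x|/=|A c IH] /=.
- move=> _ H T e e_inj ex _; apply: isys_trivial => a z; apply: e_inj.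
  have h y : e y = x by have := ex y; case: (x =P e y).
  by rewrite !h.
- by move=> _ H T e _ ex _; apply: isys_trivial => a z; have := ex z.
case=> sA c0 wc H T e e_inj ec fixt.
have stA : hs_stable (A : {set hs_pow H}).
  move=> a D DA; have [phi [[<- _] _]] := fixt a.
  exact: imset_f.
have fixc a : exists phi : X -> X,
    (forall D, tmap phi (gact (sgval a) (c D)) = c (sgval a *: D)) /\
     forall z, phi (e z) = e (hs_act a z).
  have [phi [[_ ecc] ephi]] := fixt a; exists phi; split=> // D.
  by rewrite -[in RHS]ecc -lcosetM mulVg lcoset1.
(* The label [e z] occurs once in the whole tree, hence under exactly one child of the root, which
   is in [A] since the other children are leafless. *)
have ex_root z : exists D : hs_sub stA, (0 < cnt (pred1 (e z)) (c (val D)))%N.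
  have : (0 < \sum_D cnt (pred1 (e z)) (c D))%N by rewrite ec.
  rewrite lt0n sum_nat_eq0 => /forallPn[D /=]; rewrite -lt0n => zD.
  have DA : D \in A.
    apply: contraLR zD => /c0 cD; rewrite -leqNgt -[0%N in leqRHS]cD.
    exact: leq_cnt.
  by exists (in_hs_sub stA DA).
have [p pP] := boolp.choice ex_root.
have root_uniq z D : (0 < cnt (pred1 (e z)) (c D))%N -> D = val (p z).
  move=> zD; apply/eqP/negP => /negP ne; have := ec z.
  rewrite (bigD1 D) //= (bigD1 (val (p z))) 1?eq_sym //=.
  rewrite addnA => e1.
  by have := leq_trans (leq_add zD (pP z)) (leq_trans (leq_addr _ _) (eq_leq e1)).
(* [phi] carries the leaf [e z] under a child [D] to the leaf [e (a z)] under [a D], so uniqueness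
   makes [p] equivariant. *)
have pE a z : p (hs_act a z) = hs_act a (p z).
  apply: val_inj; rewrite -(root_uniq _ (sgval a *: val (p z))) //.
  have [phi [<- <-]] := fixc a; rewrite cnt_tmap cnt_gact.
  apply: leq_trans (pP z) _; apply: leq_cnt => x /= /eqP ->; exact: eqxx.
apply: (isys_fibration pE (supported_sub stA sA)) => b K sKH stF fixb.
apply: (IH (val b) (wc _) K (hs_sub stF) (e \o sval)).
- by move=> y z /e_inj; exact: val_inj.
- move=> [z zb] /=; have := zb; rewrite inE => /eqP pz.
  apply/eqP; rewrite eqn_leq -pz pP andbT -(ec z) (bigD1 (val (p z))) //=.
  exact: leq_addr.
move=> a; have [phi [phiE ephi]] := fixc (subg_incl H a).
exists phi; split=> [|z /=]; last exact: ephi.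
have := phiE (val b); have /(congr1 val) /= -> := fixb a.
by rewrite subg_inclE.
Qed.

Definition tree_operad : GSetOperad gT :=
  Build_GSetOperad (tree_structure supported_translate).

(** A tree presenting [T] is fixed by each [a] in [H] up to a relabelling. With the points of [T]
    labelling leaves through the inverse of [e], this is the situation of [isys_of_fixed_tree]. *)
Lemma tree_operad_admissible H (T : HSet H) :
  admissible (gso_str tree_operad) T -> I H T.
Proof.
case/admissibleP => n [e [[t [wt lt]] pt]]; have [e' eK e'K] := pt.1.
apply: (isys_of_fixed_tree wt (e := e') (can_inj e'K)) => [z|a]; first exact: lt.
have [s sE /(congr1 sval) /= ts] := presents_perm pt a.
exists s; split=> [|z].
  by rewrite ts tmap_comp; apply: tmap_id_ext => i; rewrite /= sigmaKV.
by apply: (can_inj eK); rewrite sE !e'K.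
Qed.

Lemma tree_nullaryP :
  wf supported (@Stub gT 'I_0) /\ linear (@Stub gT 'I_0).
Proof. by split=> // -[]. Qed.

Definition tree_nullary : tree_operad 0%N := exist _ _ tree_nullaryP.

Lemma tree_nullary_fixed g : op_G (gso_str tree_operad) g tree_nullary = tree_nullary.
Proof. exact: sval_ext. Qed.

(* The empty and the full subset are the two subsets fixed by all translations. *)
Definition binary_term : term gT 'I_2 :=
  Node (finset.set0 |: [set [set: gT]%SET])
    (fun D => if D == finset.set0 then Leaf _ ord0
              else if D == [set: gT]%SET then Leaf _ ord_max else @Stub _ _).

Lemma setT_neq0 : ([set: gT]%SET == finset.set0) = false.
Proof. by apply/negP => /eqP /setP /(_ 1); rewrite !inE. Qed.

Lemma lcoset_set0 (g : gT) : g *: finset.set0 = finset.set0.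
Proof. by apply/setP => x; rewrite mem_lcoset !inE. Qed.

Lemma lcoset_setT (g : gT) : g *: [set: gT]%SET = [set: gT]%SET.
Proof. by apply/setP => x; rewrite mem_lcoset !inE. Qed.

Lemma tree_binaryP : wf supported binary_term /\ linear binary_term.
Proof.
split=> [|x /=].
  split=> [|D|D].
  - apply: supported_fixed => g D /set2P[] ->; [exact: lcoset_set0|exact: lcoset_setT].
  - by rewrite !inE negb_or => /andP[/negPf -> /negPf ->].
  - by case: ifP => // _; case: ifP.
rewrite (bigD1 finset.set0) //= (bigD1 [set: gT]%SET) /= ?setT_neq0 // !eqxx /=.
rewrite big1 => [|D /andP[/negPf -> /negPf ->]] //.
by case: x => [[|[|]]].
Qed.

Definition tree_binary : tree_operad 2 := exist _ _ tree_binaryP.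

Lemma tree_binary_fixed g : op_G (gso_str tree_operad) g tree_binary = tree_binary.
Proof.
apply: sval_ext; rewrite /= /binary_term; congr Node.
  by rewrite /translate imsetU1 imset_set1 lcoset_set0 lcoset_setT.
apply/funext => D; have e E : g *: E = E -> (g^-1 *: D == E) = (D == E).
  move=> gE; apply/eqP/eqP => [DE|->].
    by rewrite -gE -DE -lcosetM mulgV lcoset1.
  by rewrite -{1}gE -lcosetM mulVg lcoset1.
rewrite (e _ (lcoset_set0 g)) (e _ (lcoset_setT g)).
by case: ifP => // _; case: ifP.
Qed.

Section OrbitTree.
Variables H K : {group gT}.
Hypotheses (sKH : K \subset H) (IHK : I H (hs_orbit H K)).
Let T := hs_orbit H K.

(** A corolla supported on the cosets themselves: translation by [H] permutes its leaves as it
    permutes [H/K], and the labels follow the enumeration that defines [gammaT]. *)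
Definition orbit_term : term gT 'I_#|T| :=
  Node (lcosets K H)
    (fun D => if insub D is Some C then Leaf _ (enum_rank (C : T)) else @Stub _ _).

Lemma orbit_termP : wf supported orbit_term /\ linear orbit_term.
Proof.
split=> [|x /=].
  split=> [|D|D]; first exact: supported_lcosets.
  - by case: insubP => // C ->.
  - by case: insubP.
rewrite (bigD1 (val (enum_val x))) //= valK /= enum_valK eqxx big1 // => D.
case: insubP => // C _ <- ne /=; apply/eqP; rewrite eqb0.
by apply: contra ne => /eqP <-; rewrite enum_rankK.
Qed.

Definition orbit_tree : tree_operad #|T| := exist _ _ orbit_termP.

Lemma orbit_tree_fixed p :
  p \in gammaT T -> op_act (gso_str tree_operad) p orbit_tree = orbit_tree.
Proof.
case/imsetP => a _ ->; apply: sval_ext; rewrite /= /orbit_term /tmap /= invgK.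
have st (b : subg_of H) E : E \in lcosets K H -> sgval b *: E \in lcosets K H.
  by move=> EK; exact: (lcosets_stable b (exist _ E EK)).
have stV D : (sgval a)^-1 *: D \in lcosets K H = (D \in lcosets K H).
  apply/idP/idP => [/(st a)|/(st a^-1) //].
  by rewrite -lcosetM mulgV lcoset1.
congr Node; first by apply/finset.setP => D; rewrite mem_translate stV.
apply/funext => D.
case: insubP => [C' DC' C'E|nD]; case: insubP => [C DC CE|nD'] //=.
- congr Leaf; rewrite mk_sigmaE enum_rankK; congr enum_rank; apply: val_inj.
  by rewrite /= C'E CE -lcosetM mulgV lcoset1.
- by rewrite stV (negPf nD') in DC'.
- by rewrite stV DC in nD.
Qed.

End OrbitTree.

End TreeOperadOfIndexingSystem.

(** * Free N operads *)

Lemma OrbitSeq_ext (gT : finGroupType) (B : Type) (lev : B -> nat)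
    (Gam : forall b, {group gT * Sigma (lev b)}) b
    (C D : {C | C \in lcosets (Gam b) [set: gT * Sigma (lev b)]%SET}) :
  val C = val D -> OrbitSeq C = OrbitSeq D.
Proof. by move=> /val_inj ->. Qed.

Section MapsFromOrbits.
Variables (gT : finGroupType) (B : Type) (lev : B -> nat).
Variables (Gam : forall b, {group gT * Sigma (lev b)}) (S : SymSeq gT).
Variable x : forall b, S (lev b).
Hypothesis x_fixed : forall b p, p \in Gam b -> ss_act p (x b) = x b.

(** The universal property of an orbit: its base coset goes to [x b]. The choice made by [repr] is
    harmless because [Gam b] fixes [x b]. *)
Definition orbit_symseq_fun n (o : orbit_seq Gam n) : S n :=
  match o with OrbitSeq b C => ss_act (repr (val C)) (x b) end.

Lemma orbit_symseq_fun_map : @is_symseq_map gT (orbit_symseq Gam) S orbit_symseq_fun.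
Proof.
have reprE b q : ss_act (repr (q *: Gam b)) (x b) = ss_act q (x b).
  have /lcosetP[r rG ->] := mem_repr q (lcoset_refl (Gam b) q).
  by rewrite ss_actM x_fixed.
move=> n p o; case: o p => b [C +] p /=; case/lcosetsP => q _ ->.
by rewrite -lcosetM !reprE ss_actM.
Qed.

Definition orbit_symseq_hom : SymSeq_hom (orbit_symseq Gam) S :=
  exist _ _ orbit_symseq_fun_map.

Fact orbit_base_mem b : (Gam b : {set _}) \in lcosets (Gam b) [set: gT * Sigma (lev b)]%SET.
Proof. by apply/lcosetsP; exists 1; rewrite ?lcoset1 ?finset.in_setT. Qed.

Definition orbit_base b : orbit_symseq Gam (lev b) :=
  OrbitSeq (exist (fun C => C \in lcosets (Gam b) [set: gT * Sigma (lev b)]%SET)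
              _ (orbit_base_mem b)).

Lemma orbit_base_fixed b p : p \in Gam b -> ss_act p (orbit_base b) = orbit_base b.
Proof. by move=> pG; congr OrbitSeq; apply: val_inj; exact: lcoset_id. Qed.

Lemma orbit_baseP n (o : orbit_symseq Gam n) : exists b p,
  Tagged (orbit_symseq Gam) o = Tagged (orbit_symseq Gam) (ss_act p (orbit_base b)).
Proof.
case: o => b [C CG]; have /lcosetsP[p _ CE] := CG; exists b, p.
by congr Tagged; congr OrbitSeq; exact: val_inj.
Qed.

End MapsFromOrbits.

Lemma op_act1r gT O (s : operad_structure gT O) n g (f : O n) :
  op_act s (g, 1) f = op_G s g f.
Proof. by rewrite /op_act invg1 op_S1. Qed.

Lemma Sigma_free_map gT (O P : nat -> Type) (sO : operad_structure gT O)
    (sP : operad_structure gT P) phi :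
  is_operad_map sO sP phi -> Sigma_free sP -> Sigma_free sO.
Proof.
move=> om free n f t ft; apply: (free n (phi n f)).
by rewrite -(om_S om) ft.
Qed.

Lemma indexing_system_ext gT (I J : IndexingSystem gT) :
  isys_le I J -> isys_le J I -> I = J.
Proof.
case: I J => [I ? ? ? ? ? ? ?] [J ? ? ? ? ? ? ?] /= IJ JI.
have IJE : I = J.
  apply: functional_extensionality_dep => H; apply/funext => T.
  by apply/propext; split=> [/IJ|/JI].
by subst J; congr Build_IndexingSystem; exact: Prop_irrelevance.
Qed.

(** Parallel morphisms of [D] being equal, agreement on objects is enough; the target in the
    applications is the poset of indexing systems. *)
Lemma thin_functor_ext (C D : Category) (F G : Functor C D) :
  (forall (x y : D) (f g : mor x y), f = g) -> (forall x, F x = G x) -> F = G.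
Proof.
case: F G => [F Fm F1 FM] [G Gm G1 GM] /= thin FG.
have FGE : F = G by exact/funext.
subst G; have mE : Fm = Gm.
  by do 3 apply: functional_extensionality_dep => ?; exact: thin.
by subst Gm; congr Build_Functor; exact: Prop_irrelevance.
Qed.

(** * The free operad on the nontrivial orbits of an indexing system *)

Section FreeNOperads.
Variables (gT : finGroupType) (F : LeftAdjoint (forgetful gT)).

Section Points.
Variables (J : Type) (T : J -> {H : {group gT} & HSet H}).

Definition gen_base (b : gen_index J) : freeN F T (gen_level T b) :=
  sval (la_unit F (gen_symseq T)) _ (orbit_base (@gen_stabilizer gT J T) b).

Lemma gen_base_fixed b p : p \in gen_stabilizer T b ->
  op_act (gso_str (freeN F T)) p (gen_base b) = gen_base b.
Proof.
move=> pb; rewrite /gen_base -[op_act _ _ _]/(@ss_act gT (op_symseq _) _ _ _).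
by rewrite -(svalP (la_unit F (gen_symseq T))) orbit_base_fixed.
Qed.

Lemma freeN_nullary : (Gfixpts (gso_str (freeN F T)) (n := 0) !=set0)%classic.
Proof.
exists (gen_base (GenNullary J)) => g; rewrite -op_act1r.
have gG : (g, 1) \in gen_stabilizer T (GenNullary J).
  by apply/setXP; split; [exact: finset.in_setT|exact: group1].
exact: (gen_base_fixed gG).
Qed.

Lemma freeN_binary : (Gfixpts (gso_str (freeN F T)) (n := 2) !=set0)%classic.
Proof.
exists (gen_base (GenBinary J)) => g; rewrite -op_act1r.
have gG : (g, 1) \in gen_stabilizer T (GenBinary J).
  by apply/setXP; split; [exact: finset.in_setT|exact: group1].
exact: (gen_base_fixed gG).
Qed.

Lemma freeN_admissible al : admissible (gso_str (freeN F T)) (tagged (T al)).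
Proof. by exists (gen_base (GenAction al)) => p; exact: (@gen_base_fixed (GenAction al)). Qed.

End Points.

Section Orbits.
Variable I : IndexingSystem gT.
Local Notation O := (freeN F (@nontrivial_orbits gT I)).

(** By the universal property it suffices to choose, for each generator, a tree fixed by its
    stabilizer: the stub, the binary node, or the corolla on the cosets. *)
Lemma freeN_to_tree :
  exists phi, is_operad_map (gso_str O) (gso_str (tree_operad I)) phi.
Proof.
have ok (al : {HK | nontrivial_orbit I HK}) : (sval al).2 \subset (sval al).1 /\
    I _ (hs_orbit (sval al).1 (sval al).2).
  by move: al => [HK []].
pose x (b : gen_index {HK | nontrivial_orbit I HK}) :
    tree_operad I (gen_level (@nontrivial_orbits gT I) b) :=
  match b with
  | GenNullary => tree_nullary I
  | GenBinary => tree_binary I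
  | GenAction al => orbit_tree (ok al).1 (ok al).2
  end.
have xP b p : p \in gen_stabilizer (@nontrivial_orbits gT I) b ->
    @ss_act gT (op_symseq (tree_operad I)) _ p (x b) = x b.
  case: b p => [p|p|al p]; last exact: orbit_tree_fixed.
    case: p => g s /setXP[_ /set1gP /= ->].
    exact: etrans (op_act1r _ _ _) (tree_nullary_fixed _ _).
  case: p => g s /setXP[_ /set1gP /= ->].
  exact: etrans (op_act1r _ _ _) (tree_binary_fixed _ _).
have [f _] := la_universal F (d := tree_operad I) (orbit_symseq_hom xP).
by exists (sval f); exact: (svalP f).
Qed.

Lemma freeN_N_operad : N_operad O.
Proof.
split; [|exact: freeN_nullary|exact: freeN_binary].
by have [phi om] := freeN_to_tree; apply: (Sigma_free_map om); exact: tree_Sigma_free.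
Qed.

Definition freeN_NOp : NOp gT := exist _ O freeN_N_operad.

Lemma admissible_freeN : A_N gT freeN_NOp = I.
Proof.
apply: indexing_system_ext.
  move=> H T adT; have [phi om] := freeN_to_tree.
  exact: (tree_operad_admissible (admissible_map om adT)).
apply: isys_le_orbits => H K sKH neKH IHK.
have al : nontrivial_orbit I (H, K) by split.
exact: (freeN_admissible (@nontrivial_orbits gT I) (exist _ _ al)).
Qed.

Lemma freeN_finitely_generated : finitely_generated_free F O.
Proof.
exists (gen_symseq (@nontrivial_orbits gT I)); last first.
  by exists (idmor _), (idmor _); split; exact: cmp1m.
pose base b : {n : nat & gen_symseq (@nontrivial_orbits gT I) n} :=
  Tagged _ (orbit_base (@gen_stabilizer gT _ (@nontrivial_orbits gT I)) b).
(* All pairs of subgroups form a finite index type; a pair that is not a nontrivial orbit in [I]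
   gets the nullary generator, a harmless repetition. *)
pose y (b : option (option ({group gT} * {group gT}))) :=
  match b with
  | None => base (GenNullary _)
  | Some None => base (GenBinary _)
  | Some (Some HK) => if pselect (nontrivial_orbit I HK) is left al
                      then base (GenAction (exist _ HK al)) else base (GenNullary _)
  end.
have yP b : exists c, y c = base b.
  case: b => [||[HK al]]; [by exists None|by exists (Some None)|].
  exists (Some (Some HK)); rewrite /y; case: pselect => // al'.
  by congr (base (GenAction _)); exact: sval_ext.
exists _, y => n o; have [b [p oE]] := orbit_baseP o.
by have [c cE] := yP b; exists c; rewrite cE; exists p.
Qed.

End Orbits.

(** The proof component of an index changes along an inclusion; identifying these proofs makes the
    functor laws hold as equalities. *)
Lemma GenAction_irr (I : IndexingSystem gT) HK (p q : nontrivial_orbit I HK)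
    (C : {C | C \in lcosets (gammaT (hs_orbit HK.1 HK.2)) [set: _]%SET}) :
  @OrbitSeq gT _ _ (@gen_stabilizer gT _ (@nontrivial_orbits gT I))
    (GenAction (exist _ HK p)) C =
  @OrbitSeq gT _ _ (@gen_stabilizer gT _ (@nontrivial_orbits gT I))
    (GenAction (exist _ HK q)) C.
Proof. by rewrite (Prop_irrelevance p q). Qed.

Section Inclusion.
Variables (I J : IndexingSystem gT) (IJ : isys_le I J).

Definition nontrivial_orbit_incl (al : {HK | nontrivial_orbit I HK}) :
  {HK | nontrivial_orbit J HK}.
Proof. by exists (sval al); case: al => HK [sub neq IHK]; split=> //; exact: IJ. Defined.

(** The underlying pair of subgroups is unchanged, so both generators have the same stabilizer by
    conversion and the coset [C] is reused as it is. *)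
Definition gen_incl n (o : gen_symseq (@nontrivial_orbits gT I) n) :
  gen_symseq (@nontrivial_orbits gT J) n.
Proof.
pose orb := @OrbitSeq gT _ _ (@gen_stabilizer gT _ (@nontrivial_orbits gT J)).
case: o => -[||al] C.
- exact: (orb (GenNullary _) C).
- exact: (orb (GenBinary _) C).
- exact: (orb (GenAction (nontrivial_orbit_incl al)) C).
Defined.

Lemma gen_incl_map : @is_symseq_map gT (gen_symseq _) (gen_symseq _) gen_incl.
Proof.
move=> n p o.
pose ext b := @OrbitSeq_ext gT _ _ (@gen_stabilizer gT _ (@nontrivial_orbits gT J)) b.
case: o p => [[||al]] C p; first exact: (ext (GenNullary _)).
  exact: (ext (GenBinary _)).
exact: (ext (GenAction (nontrivial_orbit_incl al))).
Qed.

Definition gen_incl_hom : SymSeq_hom (gen_symseq _) (gen_symseq _) :=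
  exist _ _ gen_incl_map.

End Inclusion.

Definition free_section : Functor (IndCat gT) (NOp gT).
Proof.
exists freeN_NOp (fun I J (IJ : isys_le I J) => fmor F (gen_incl_hom IJ)).
- move=> I; rewrite -[RHS]fmor1; congr (fmor F); apply: symseq_hom_ext => n o.
  by case: o => [[||[HK p]]] C //=; exact: (@GenAction_irr I HK _ p C).
- move=> I J L g f; rewrite -[RHS]fmorM; congr (fmor F); apply: symseq_hom_ext => n o.
  by case: o => [[||[HK p]]] C //=; exact: (@GenAction_irr L HK _ _ C).
Defined.

Lemma free_section_sectionP : functorial_section (A_N gT) free_section.
Proof.
apply: thin_functor_ext => [I J f g|I]; first exact: (@Prop_irrelevance (isys_le _ _)).
exact: admissible_freeN.
Qed.

End FreeNOperads.

(** * Spaces of step functions *)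

Section StepFunctions.
Variable R : realType.
Local Open Scope classical_set_scope.
Local Open Scope ring_scope.

(* An outer measure: A is arbitrary. *)
Definition leb (A : set R) : R := fine (lebesgue_measure (A `&` `[0, 1[%classic)).

Lemma leb_fin A : lebesgue_measure (A `&` `[0%R, 1%R[%classic : set R) \is a fin_num.
Proof.
have le1 : (lebesgue_measure (A `&` `[0%R, 1%R[%classic : set R) <= 1%:E)%E.
  apply: (@le_trans _ _ (lebesgue_measure (`[0%R, 1%R[%classic : set R))).
    by apply: le_outer_measure; exact: subIsetr.
  by rewrite lebesgue_measure_itv /= lte_fin ltr01 sube0.
rewrite ge0_fin_numE; first exact: le_lt_trans le1 (ltry _).
exact: outer_measure_ge0.
Qed.

Lemma le_leb A B : A `<=` B -> leb A <= leb B.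
Proof.
move=> AB; apply: fine_le; rewrite ?leb_fin //.
by apply: le_outer_measure; exact: setSI.
Qed.

Lemma lebU A B : leb (A `|` B) <= leb A + leb B.
Proof.
rewrite -fineD ?leb_fin //; apply: fine_le; rewrite ?fin_numD ?leb_fin //.
by rewrite setIUl; exact: outer_measureU2.
Qed.

Lemma leb0 : leb set0 = 0.
Proof. by rewrite /leb set0I measure0. Qed.

Lemma leb_itv_le a b : a <= b -> leb `[a, b[%classic <= b - a.
Proof.
move=> ab; rewrite -lee_fin fineK ?leb_fin //.
apply: (@le_trans _ _ (lebesgue_measure (`[a, b[%classic : set R))).
  by apply: le_outer_measure; exact: subIsetl.
rewrite lebesgue_measure_itv /= lte_fin; case: ifP => // _.
by rewrite lee_fin subr_ge0.
Qed.

Lemma leb_itv_gt0 a b : 0 <= a -> a < b -> b <= 1 -> 0 < leb `[a, b[%classic.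
Proof.
move=> a0 ab b1; rewrite /leb setIidl.
  by rewrite lebesgue_measure_itv /= lte_fin ab /= subr_gt0.
move=> x /=; rewrite !in_itv /= => /andP[ax xb].
by rewrite (le_trans a0 ax) (lt_le_trans xb b1).
Qed.

Definition unit_dom : Type := {x : R | 0 <= x < 1}.

Fact unit_dom0_subproof : 0 <= (0 : R) < 1.
Proof. by rewrite lexx ltr01. Qed.

Definition unit_dom0 : unit_dom := exist _ 0 unit_dom0_subproof.

(** Right-continuity for the discrete topology on [X]. It makes functions that differ only on a null
    set equal. *)
Definition right_constant (X : Type) (f : unit_dom -> X) : Prop :=
  forall d, exists2 e : R, 0 < e &
    forall d', sval d <= sval d' < sval d + e -> f d' = f d.

Definition step (X : Type) : Type := {f : unit_dom -> X | right_constant f}.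

Section Step.
Variable X : Type.

HB.instance Definition _ := gen_eqMixin (step X).
HB.instance Definition _ := gen_choiceMixin (step X).

Definition diff_set (f g : step X) : set R :=
  [set x | exists h : 0 <= x < 1, sval f (exist _ x h) <> sval g (exist _ x h)].

Lemma diff_set_sym f g : diff_set f g = diff_set g f.
Proof. by apply/seteqP; split=> x [h ne]; exists h => /esym. Qed.

Lemma diff_set_trans f g k : diff_set f k `<=` diff_set f g `|` diff_set g k.
Proof.
move=> x [h ne]; case: (pselect (sval f (exist _ x h) = sval g (exist _ x h))) => fg.
  by right; exists h; rewrite -fg.
by left; exists h.
Qed.

Lemma diff_setxx f : diff_set f f = set0.
Proof. by apply/seteqP; split=> x // [h]. Qed.

Definition step_dist (f g : step X) : R := leb (diff_set f g).

Lemma step_distxx f : step_dist f f = 0.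
Proof. by rewrite /step_dist diff_setxx leb0. Qed.

Lemma step_dist_sym f g : step_dist f g = step_dist g f.
Proof. by rewrite /step_dist diff_set_sym. Qed.

Lemma step_dist_triangle g f k : step_dist f k <= step_dist f g + step_dist g k.
Proof. exact: le_trans (le_leb (@diff_set_trans f g k)) (lebU _ _). Qed.

(** If [f] and [g] differ at [x], right-continuity makes them differ on an interval starting at [x],
    which has positive measure. *)
Lemma step_dist_eq0 f g : step_dist f g = 0 -> f = g.
Proof.
move=> fg0; apply: sval_ext; apply/funext => -[x x01].
apply: contrapT => ne.
have [e1 e10 fe] := svalP f (exist _ x x01).
have [e2 e20 ge] := svalP g (exist _ x x01).
have [x0 x1] := andP x01.
(* Up to [b] both functions keep their values at [x], and the domain is not left. *)
pose b := Num.min (x + Num.min e1 e2) 1.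
have xb : x < b by rewrite lt_min x1 andbT ltrDl lt_min e10.
have b1 : b <= 1 by rewrite ge_min lexx orbT.
have := leb_itv_gt0 x0 xb b1; rewrite ltNge; apply/negP/negPn.
rewrite -fg0; apply: le_leb => y /=; rewrite in_itv /= => /andP[xy yb].
have y01 : 0 <= y < 1 by rewrite (le_trans x0 xy) (lt_le_trans yb b1).
exists y01; rewrite (fe (exist _ y y01)) ?(ge (exist _ y y01)) //= xy /=.
  by apply: (lt_le_trans yb); rewrite ge_min lerD2l ge_min lexx !orbT.
by apply: (lt_le_trans yb); rewrite ge_min lerD2l ge_min lexx.
Qed.

HB.instance Definition _ := @isMetric.Build R (step X) step_dist
  step_distxx step_dist_eq0 step_dist_sym step_dist_triangle.

Lemma step_ballE (f g : step X) e : ball f e g = (step_dist f g < e) :> Prop.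
Proof. by rewrite ballEmdist. Qed.

End Step.
End StepFunctions.

(** * Compact generation and the weak Hausdorff property *)

Section MetricSpacesAreCompactlyGenerated.
Local Open Scope classical_set_scope.
Local Open Scope ring_scope.

Lemma nat_compact_lt (N : nat) : compact [set n | (n < N)%N].
Proof.
elim: N => [|N IH].
  rewrite (_ : mkset _ = set0); first exact: compact0.
  by apply/seteqP; split=> n.
rewrite (_ : mkset _ = [set n | (n < N)%N] `|` [set N]); last first.
  apply/seteqP; split=> n /=; last by case=> [/leqW|->].
  by rewrite ltnS leq_eqVlt => /orP[/eqP ->|]; [right|left].
by apply: compactU => //; exact: compact_set1.
Qed.

Lemma nat_not_compact : ~ compact [set: nat].
Proof.
move=> /(_ \oo _ filterT)[p [_ clp]].
have [n [/= pn np]] := clp _ _ (nbhs_infty_gt p) (discrete_set1 p).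
by rewrite np ltnn in pn.
Qed.

Lemma nat_locally_compact : locally_compact [set: nat].
Proof.
move=> n _; exists [set n] => /=; first by move=> m nm _; exact: nm.
by split; [exact: compact_set1|exact: discrete_closed].
Qed.

(** If no ball around [x] lies in [U], points outside [U] converge to [x]. The resulting map from
    the one-point compactification of [nat] would pull [U] back to a neighbourhood of infinity
    containing no natural number. *)
Lemma pseudometric_compactly_generated (R : realType) (M : pseudoMetricType R) :
  compactly_generated M.
Proof.
move=> U kU; rewrite openE => x Ux; rewrite /interior -nbhs_ballE.
apply: contrapT => nball.
have /boolp.choice[y yP] (n : nat) : exists y, ball x (n.+1%:R^-1 : R) y /\ ~ U y.
  apply: contrapT => nex; apply: nball; exists n.+1%:R^-1 => //=.
  by move=> z bz; apply: contrapT => nUz; apply: nex; exists z.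
(* Test U on the convergent sequence y, a map from a compact space. *)
pose u (o : one_point_compactification nat) : M := if o is Some n then y n else x.
have cu : continuous u.
  case=> [n|] V /=.
    by move=> Vyn; apply/principal_filterP; exact: (nbhs_singleton Vyn).
  rewrite -nbhs_ballE => -[e e0 eV].
  have [N Ne] : exists N : nat, N.+1%:R^-1 < e.
    have := near_infty_natSinv_lt (PosNum e0); case=> N _ /(_ N (leqnn N)) /=.
    by exists N.
  exists [set n | (n < N)%N].
    by split; [exact: nat_compact_lt|exact: discrete_closed].
  move=> _ [[n nN <-]|->]; apply: eV; last exact: ballxx.
  apply: le_ball (yP n).1; apply: le_trans (ltW Ne).
  rewrite lef_pV2 ?posrE // ler_nat ltnS leqNgt; exact/negP.
have : open (u @^-1` U).
  apply: kU cu; first exact: one_point_compactification_compact.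
  apply: one_point_compactification_hausdorff; first exact: nat_locally_compact.
  exact: discrete_hausdorff.
(* A neighbourhood of infinity contains the complement of a compact [C]; here [C] would be all of
   [nat]. *)
rewrite openE => /(_ None Ux)[C [cC _] CU].
apply: nat_not_compact; suff <- : C = setT by [].
apply/seteqP; split=> // n _; apply: contrapT => nC.
by apply: (yP n).2; apply: (CU (Some n)); left; exists n.
Qed.

Lemma hausdorff_weak_hausdorff (X : topologicalType) :
  hausdorff_space X -> weak_hausdorff X.
Proof.
move=> hX K u cK _ cu; apply: compact_closed => //.
by apply: continuous_compact => //; exact: continuous_subspaceT.
Qed.

(** The topology of [kspace X] is finer: an open set has open preimage under every continuous
    [u]. *)
Lemma kspace_continuous (X Y : topologicalType) (f : X -> Y) :
  continuous f -> continuous (f : kspace X -> Y).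
Proof.
move=> /continuousP cf; apply/continuousP => V /cf oV.
by move=> K u _ _ /continuousP; exact.
Qed.

End MetricSpacesAreCompactlyGenerated.

(** * Continuity from metric estimates *)

Section PseudoMetricContinuity.
Local Open Scope classical_set_scope.
Local Open Scope ring_scope.
Variable R : realType.

Lemma nonexpansive_continuous (M N : pseudoMetricType R) (f : M -> N) :
  (forall x y e, ball x e y -> ball (f x) e (f y)) -> continuous f.
Proof.
move=> fball x; apply/cvg_ballP => e e0; near=> y.
by apply: fball; near: y; exact: near_ball.
Unshelve. all: by end_near. Qed.

(** As [I] is finite, the points within [d] in every coordinate form a neighbourhood for the product
    topology. *)
Lemma continuous_of_coordinates (I : finType) (M P : pseudoMetricType R)
    (N : I -> pseudoMetricType R) (f : M * prod_topology N -> P) :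
  (forall e : R, 0 < e -> exists2 d : R, 0 < d & forall p q, ball p.1 d q.1 ->
     (forall i, ball (p.2 i) d (q.2 i)) -> ball (f p) e (f q)) ->
  continuous f.
Proof.
move=> fP p; apply/cvg_ballP => e /fP[d d0 fd].
have n1 : \forall q \near p, ball p.1 d q.1.
  by apply: (cvg_fst (F := nbhs p.1) (G := nbhs p.2)); exact: nbhsx_ballx.
have n2 : \forall q \near p, forall i, ball (p.2 i) d (q.2 i).
  apply: (@filter_forall _ I (fun i q => ball (p.2 i) d (q.2 i)) (nbhs p)) => i.
  have nd : nbhs p.2 [set g : prod_topology N | ball (p.2 i) d (g i)].
    by apply: (@proj_continuous _ N i p.2 (ball (p.2 i) d)); exact: nbhsx_ballx.
  exists ([set: M], [set g : prod_topology N | ball (p.2 i) d (g i)]).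
    by split=> //=; exact: filterT.
  by move=> q [].
near=> q; apply: fd; [near: q; exact: n1|near: q; exact: n2].
Unshelve. all: by end_near. Qed.

Lemma lipschitz_continuous2 (A : topologicalType) (M N P : pseudoMetricType R)
    (f : M -> N -> P) (a : A -> M) (b : A -> N) :
  (forall x x' y y' e, ball x e x' -> ball y e y' -> ball (f x y) (e + e) (f x' y')) ->
  continuous a -> continuous b -> continuous (fun z => f (a z) (b z)).
Proof.
move=> fP ca cb z; apply/cvg_ballP => e e0.
have e20 : 0 < e / 2 by rewrite divr_gt0.
have na : \forall z' \near z, ball (a z) (e / 2) (a z').
  by move: (ca z) => /cvg_ballP; exact.
have nb : \forall z' \near z, ball (b z) (e / 2) (b z').
  by move: (cb z) => /cvg_ballP; exact.
near=> z'; rewrite (splitr e); apply: fP; [near: z'; exact: na|near: z'; exact: nb].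
Unshelve. all: by end_near. Qed.

End PseudoMetricContinuity.

(** * Pointwise operations on step functions *)

Section StepOperad.
Variable R : realType.
Local Open Scope classical_set_scope.
Local Open Scope ring_scope.

Lemma right_constant_all (I : finType) (X : I -> Type)
    (f : forall i, unit_dom R -> X i) : (forall i, right_constant (f i)) ->
  right_constant (fun x i => f i x).
Proof.
move=> cf d; have /boolp.choice[e eP] i : exists e : R, 0 < e /\
    forall d', sval d <= sval d' < sval d + e -> f i d' = f i d.
  by have [e e0 fe] := cf i d; exists e.
(* The least of finitely many radii; the default 1 keeps it positive when [I] is empty. *)
exists (\big[Num.min/1]_i e i).
  by apply/bigmin_gtP; split=> [|i _]; [exact: ltr01|have [] := eP i].
move=> d' /andP[dd' d'd]; apply: functional_extensionality_dep => i.
apply: (eP i).2; rewrite dd' (lt_le_trans d'd) // lerD2l.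
exact: bigmin_le.
Qed.

Lemma right_constant_pair (X Y : Type) (f : unit_dom R -> X) (g : unit_dom R -> Y) :
  right_constant f -> right_constant g -> right_constant (fun x => (f x, g x)).
Proof.
move=> cf cg d; have [e e0 fe] := cf d; have [e' e'0 ge] := cg d.
exists (Num.min e e'); first by rewrite lt_min e0.
move=> d' /andP[dd']; rewrite -ltrBlDl lt_min !ltrBlDl => /andP[de de'].
by rewrite fe ?ge ?dd'.
Qed.

Lemma right_constant_comp (X Y : Type) (h : X -> Y) (f : unit_dom R -> X) :
  right_constant f -> right_constant (fun x => h (f x)).
Proof. by move=> cf d; have [e e0 fe] := cf d; exists e => // d' /fe ->. Qed.

Definition step_map (X Y : Type) (h : X -> Y) (f : step R X) : step R Y :=
  exist _ _ (right_constant_comp h (svalP f)).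

Lemma right_constant_cst (X : Type) (x : X) : right_constant (fun _ : unit_dom R => x).
Proof. by move=> d; exists 1 => //; exact: ltr01. Qed.

Definition step_cst (X : Type) (x : X) : step R X := exist _ _ (right_constant_cst x).

Lemma step_mapE X Y (h : X -> Y) f x : sval (step_map h f) x = h (sval f x).
Proof. by []. Qed.

Lemma step_ext X (f g : step R X) : (forall x, sval f x = sval g x) -> f = g.
Proof. by move=> fg; apply: sval_ext; exact/funext. Qed.

Lemma step_map_dist X Y (h : X -> Y) (f g : step R X) :
  step_dist (step_map h f) (step_map h g) <= step_dist f g.
Proof.
apply: le_leb => x [x01 ne]; exists x01; apply: contra_not ne => fg.
by rewrite !step_mapE fg.
Qed.

Lemma step_map_continuous X Y (h : X -> Y) : continuous (@step_map X Y h).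
Proof.
apply: (nonexpansive_continuous (R := R)) => f g e.
by rewrite !step_ballE; exact/le_lt_trans/step_map_dist.
Qed.

Lemma leb_sub_sum (I : finType) (A : set R) (B : I -> set R) :
  (forall x, A x -> exists i, B i x) -> leb A <= \sum_i leb (B i).
Proof.
move=> AB; apply: (@le_trans _ _ (leb [set x | exists2 i, i \in enum I & B i x])).
  by apply: le_leb => x /AB[i Bx]; exists i; rewrite ?mem_enum.
have -> : \sum_i leb (B i) = \sum_(i <- enum I) leb (B i) by rewrite big_enum.
elim: (enum I) => [|i r IH].
  rewrite big_nil -[leRHS](leb0 R); apply: le_leb => x [i].
  by rewrite in_nil.
rewrite big_cons; apply: le_trans (lerD (lexx _) IH).
apply: le_trans (lebU _ _); apply: le_leb => x [i' + Bx].
by rewrite inE => /orP[/eqP <-|i'r]; [left|right; exists i'].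
Qed.

Variables (gT : finGroupType) (O : nat -> Type) (s : operad_structure gT O).

Definition step_level (n : nat) : Type := step R (O n).

Section Comp.
Variables (k : nat) (j : 'I_k -> nat).

Fact step_compP (c : step_level k) (d : forall i, step_level (j i)) :
  right_constant (fun x => op_comp s (sval c x) (fun i => sval (d i) x)).
Proof.
apply: (right_constant_comp (fun p => op_comp s p.1 p.2)
  (right_constant_pair (svalP c) (right_constant_all (fun i => svalP (d i))))).
Qed.

Definition step_comp (c : step_level k) (d : forall i, step_level (j i)) :
  step_level (\sum_i j i)%N := exist _ _ (step_compP c d).

(** Two composites can differ at a point only where some pair of inputs differs, and [leb] is
    finitely subadditive. *)
Lemma step_comp_dist c c' d d' :
  step_dist (step_comp c d) (step_comp c' d') <=
  step_dist c c' + \sum_i step_dist (d i) (d' i).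
Proof.
pose B := [set x | exists i, diff_set (d i) (d' i) x].
apply: (@le_trans _ _ (leb (diff_set c c' `|` B))); last first.
  by apply: le_trans (lebU _ _) (lerD (lexx _) _); apply: leb_sub_sum.
apply: le_leb => x [x01 ne]; apply: contra_notP ne => /not_orP[nc nB] /=.
have -> : sval c (exist _ x x01) = sval c' (exist _ x x01).
  by apply: contra_notP nc; exists x01.
congr op_comp; apply: functional_extensionality_dep => i.
by apply: contra_notP nB; exists i, x01.
Qed.

End Comp.
End StepOperad.

(** * N-infinity operads of step functions *)

Section StepOperadStructure.
Variable R : realType.
Local Open Scope classical_set_scope.
Local Open Scope ring_scope.

Lemma step_Tagged (O : nat -> Type) n m (f : step R (O n)) (g : step R (O m)) :
  (forall x, Tagged O (sval f x) = Tagged O (sval g x)) ->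
  Tagged (fun n => step R (O n)) f = Tagged (fun n => step R (O n)) g.
Proof.
(* The arities are compared at the point 0 of the domain. *)
move=> fg; have nm : n = m := congr1 tag (fg (unit_dom0 R)).
by subst m; congr Tagged; apply: step_ext => x; exact: Tagged_inj.
Qed.

Section Structure.
Variables (gT : finGroupType) (O : nat -> Type) (s : operad_structure gT O).

Definition step_structure : operad_structure gT (step_level R O).
Proof.
refine {| op_G := fun n g => step_map (op_G s g);
          op_S := fun n f t => step_map (fun x => op_S s x t) f;
          op_id := step_cst R (op_id s);
          op_comp := @step_comp R gT O s |}.
- by move=> n f; apply: step_ext => x; exact: op_G1.
- by move=> n g h f; apply: step_ext => x; exact: op_GM.
- by move=> n f; apply: step_ext => x; exact: op_S1.
- by move=> n f t u; apply: step_ext => x; exact: op_SM.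
- by move=> n g f t; apply: step_ext => x; exact: op_GS.
- by move=> g; apply: step_ext => x; exact: op_G_id.
- by move=> g k j c d; apply: step_ext => x; exact: op_G_comp.
- by move=> n f; apply: step_Tagged => x; exact: op_comp1l.
- by move=> n f; apply: step_Tagged => x; exact: op_comp1r.
- move=> k j m c d e; apply: step_Tagged => x.
  exact: (op_compA s (sval c x) (fun i => sval (d i) x) (fun i l => sval (e i l) x)).
- move=> k j c d t; apply: step_Tagged => x.
  exact: (op_comp_block_perm s (sval c x) (fun i => sval (d i) x)).
- move=> k j c d t; apply: step_ext => x.
  exact: (op_comp_block_sum s (sval c x) (fun i => sval (d i) x)).
Defined.

Lemma step_comp_continuous k (j : 'I_k -> nat) :
  continuous ((fun p => step_comp s p.1 p.2) :
    step R (O k) * prod_topology (fun i => step R (O (j i))) ->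
    step R (O (\sum_i j i)%N)).
Proof.
apply: (continuous_of_coordinates (R := R)) => e e0.
(* There are [k + 1] inputs, [c] and the [k] entries of [d], and each gets an equal share of [e]. *)
exists (e / k.+1%:R); first by rewrite divr_gt0 // ltr0n.
move=> p q p1 p2; rewrite step_ballE; apply: le_lt_trans (step_comp_dist _ _ _ _ _) _.
apply: (@lt_le_trans _ _ (e / k.+1%:R + \sum_(i < k) e / k.+1%:R)).
  apply: ltr_leD; first by rewrite -step_ballE.
  by apply: ler_sum => i _; apply: ltW; rewrite -step_ballE.
by rewrite sumr_const card_ord -mulrS -[e / _ *+ _]mulr_natr divfK // pnatr_eq0.
Qed.

Definition step_operad : GSpaceOperad gT.
Proof.
refine (@Build_GSpaceOperad gT (fun n => step R (O n) : topologicalType)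
  step_structure _ _ _ _ _).
- move=> n; exact: (@pseudometric_compactly_generated R).
- move=> n; apply: hausdorff_weak_hausdorff; exact: metric_hausdorff.
- move=> n g; exact: step_map_continuous.
- move=> n t; exact: step_map_continuous.
- by move=> k j; apply: kspace_continuous; exact: step_comp_continuous.
Defined.

Lemma step_fixpts n (Gam : {set gT * Sigma n}) (f : step R (O n)) :
  fixpts step_structure Gam f <-> forall x, fixpts s Gam (sval f x).
Proof.
split=> [ff x p pG|ff p pG].
  exact: (congr1 (fun g : step R (O n) => sval g x) (ff p pG)).
by apply: step_ext => x; exact: ff.
Qed.

(** Constant functions and evaluation at 0 pass between the two sets; hence both operads have the
    same admissible sets. *)
Lemma step_fixpts_nonempty n (Gam : {set gT * Sigma n}) :
  fixpts step_structure Gam !=set0 <-> fixpts s Gam !=set0.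
Proof.
split=> [[f /step_fixpts ff]|[x fx]].
  by exists (sval f (unit_dom0 R)).
by exists (step_cst R x); apply/step_fixpts.
Qed.

Lemma step_Gfixpts n :
  Gfixpts s (n := n) !=set0 -> Gfixpts step_structure (n := n) !=set0.
Proof.
by case=> x fx; exists (step_cst R x) => g; apply: step_ext => y; exact: fx.
Qed.

Lemma step_Sigma_free : Sigma_free s -> Sigma_free step_structure.
Proof.
move=> free n f t ft; apply: (free n (sval f (unit_dom0 R))).
exact: (congr1 (fun g : step R (O n) => sval g (unit_dom0 R)) ft).
Qed.

Lemma step_admissible (H : {group gT}) (T : HSet H) :
  admissible step_structure T <-> admissible s T.
Proof. exact: step_fixpts_nonempty. Qed.

End Structure.

(** * Contraction by overwriting *)

Section Contraction.
Variables (X : Type) (x0 : X).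

(** Left of [t] the new value persists up to [t]; from [t] on the radius of [f] works. The strict
    comparison leaves the value at [t] itself to [f]. *)
Lemma right_constant_until (t : R) (f : unit_dom R -> X) : right_constant f ->
  right_constant (fun x => if sval x < t then x0 else f x).
Proof.
move=> cf d; have [e e0 fe] := cf d; have [dt|td] := ltP (sval d) t.
  exists (t - sval d) => [|d' /andP[_]]; first by rewrite subr_gt0.
  by rewrite addrC subrK => ->.
exists e => // d' dd'; rewrite ltNge (le_trans td) //=; first exact: fe.
by case/andP: dd'.
Qed.

Definition step_until (f : step R X) (t : R) : step R X :=
  exist _ _ (right_constant_until t (svalP f)).

Lemma step_until0 f : step_until f 0 = f.
Proof. by apply: step_ext => -[x x01] /=; rewrite ltNge; case/andP: (x01) => ->. Qed.

Lemma step_until1 f : step_until f 1 = step_cst R x0.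
Proof. by apply: step_ext => -[x x01] /=; case/andP: (x01) => _ ->. Qed.

(** The two functions differ only where [f] and [g] do or between [t] and [u]. The estimate yields
    joint continuity in function and time. *)
Lemma step_until_dist f g t u :
  step_dist (step_until f t) (step_until g u) <= step_dist f g + `|t - u|.
Proof.
wlog tu : f g t u / t <= u => [hw|].
  have [/hw//|/ltW/hw h] := leP t u.
  by rewrite step_dist_sym distrC (step_dist_sym f).
rewrite distrC ger0_norm ?subr_ge0 //.
apply: le_trans (lerD (lexx _) (leb_itv_le tu)); apply: le_trans (lebU _ _).
apply: le_leb => x [x01] /=; rewrite in_itv /=.
case: (ltP x t) => [xt|tx]; first by rewrite (lt_le_trans xt tu).
case: (ltP x u) => [xu _|ux ne]; first by right.
by left; exists x01.
Qed.

Lemma step_until_continuous (A : topologicalType) (a : A -> step R X) (t : A -> R) :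
  continuous a -> continuous t -> continuous (fun z => step_until (a z) (t z)).
Proof.
apply: (lipschitz_continuous2 (R := R)) => f g u v e.
rewrite !step_ballE => fg uv; apply: le_lt_trans (step_until_dist _ _ _ _) _.
exact: ltrD.
Qed.

End Contraction.

Section Ninf.
Variables (gT : finGroupType) (O : GSetOperad gT).

(** Overwriting with [x], itself fixed by [Gam], keeps a fixed function fixed, so the contraction
    restricts to the fixed points. *)
Lemma step_fixpts_contractible n (Gam : {set gT * Sigma n}) :
  fixpts (gso_str O) Gam !=set0 ->
  contractible R (fixpts (step_structure (gso_str O)) Gam).
Proof.
case=> x fx; set F := fixpts _ Gam.
have FP (f : F) t : step_until x (set_val f) t \in F.
  apply/mem_set/step_fixpts => y /=; case: ifP => // _.
  by move: y; apply/step_fixpts/set_mem; exact: valP f.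
have FxP : step_cst R x \in F by apply/mem_set/step_fixpts.
pose inF y (yF : y \in F) : F := exist (fun y => y \in F) y yF.
pose h (p : F * R) : F := inF _ (FP p.1 p.2).
exists (inF _ FxP), h; split.
- apply: continuous_subspaceT.
  (* The fixed set has the initial topology for its inclusion, so continuity is checked after
     composing with it. *)
  apply: (continuous_comp_initial (w := set_val : F -> step R (O n))).
  apply: step_until_continuous => p; last exact: cvg_snd.
  apply: (continuous_comp (f := fst)); first exact: cvg_fst.
  exact: initial_continuous.
- by move=> f; apply: val_inj; exact: step_until0.
- by move=> f; apply: val_inj; exact: step_until1.
Qed.

Lemma step_Ninf_operad : N_operad O -> Ninf_operad R (step_operad (gso_str O)).
Proof.
case=> free nul bin; split; [exact: step_Sigma_free| |exact: step_Gfixpts..].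
move=> n Gam _; have [fx|nfx] := pselect (fixpts (gso_str O) Gam !=set0).
  by right; exact: step_fixpts_contractible.
left; apply/seteqP; split=> // f ff; apply: nfx.
by apply/step_fixpts_nonempty; exists f.
Qed.

Lemma step_map_operad_map (P : GSetOperad gT) (phi : GSetOperad_hom O P) :
  @is_cont_operad_map gT (step_operad (gso_str O)) (step_operad (gso_str P))
    (fun n => step_map (sval phi n)).
Proof.
split=> [|n]; last exact: step_map_continuous.
split.
- by move=> n g f; apply: step_ext => x; exact: (om_G (svalP phi)).
- by move=> n f t; apply: step_ext => x; exact: (om_S (svalP phi)).
- by apply: step_ext => x; exact: (om_id (svalP phi)).
- by move=> k j c d; apply: step_ext => x; exact: (om_comp (svalP phi)).
Qed.

End Ninf.

Definition step_functor (gT : finGroupType) : Functor (NOp gT) (NinfOp R gT).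
Proof.
exists (fun O => exist _ _ (step_Ninf_operad (svalP O)))
  (fun O P phi => exist _ _ (step_map_operad_map phi)).
- move=> O; apply: sval_ext; apply: functional_extensionality_dep => n.
  by apply/funext => f; exact: step_ext.
- move=> O P Q psi phi; apply: sval_ext; apply: functional_extensionality_dep => n.
  by apply/funext => f; exact: step_ext.
Defined.

Lemma A_Ninf_step (gT : finGroupType) (O : NOp gT) :
  A_Ninf R gT (step_functor gT O) = A_N gT O.
Proof. by apply: indexing_system_ext => H T /=; apply step_admissible. Qed.

End StepOperadStructure.

Theorem theorem4p9 (R : realType) (gT : finGroupType) :
  (exists S : Functor (IndCat gT) (NinfOp R gT),
     functorial_section (A_Ninf R gT) S) /\
  (exists S : Functor (IndCat gT) (NOp gT), functorial_section (A_N gT) S) /\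
  inhabited (LeftAdjoint (forgetful gT)) /\
  forall F : LeftAdjoint (forgetful gT),
    (exists S : Functor (IndCat gT) (NOp gT),
       functorial_section (A_N gT) S /\
       forall I : IndexingSystem gT, sval (S I) = freeN F (@nontrivial_orbits gT I)) /\
    (forall I : IndexingSystem gT,
       finitely_generated_free F (freeN F (@nontrivial_orbits gT I))).
Proof.
split; last split; last split.
(* Passing to step functions leaves admissible sets unchanged, so it carries the free section to a
   section for N-infinity operads. *)
- exists (functor_comp (step_functor R gT) (free_section (free_adjoint gT))).
  apply: thin_functor_ext => [I J f g|I].
    exact: (@Prop_irrelevance (isys_le _ _)).
  exact: etrans (A_Ninf_step R (freeN_NOp _ I)) (admissible_freeN _ I).
- exists (free_section (free_adjoint gT)); exact: free_section_sectionP.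
- by constructor; exact: free_adjoint.
move=> F; split; last exact: freeN_finitely_generated.
by exists (free_section F); split=> //; exact: free_section_sectionP.
Qed.
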